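(* Let $N\ge2$, $k>0$, and let $f:[0,\infty)\times\mathbb{R}\to\mathbb{R}$ satisfy the following assumptions, where $F(r,u)=\int_0^uf(r,s)\,ds$: $(g_1)$ $f\in C([0,\infty)\times\mathbb{R})$ with $f(\cdot,0)=0$, and $f$ is locally Lipschitz continuous with respect to $u\in\mathbb{R}$. $(g_2)$ $0\le F(r,u)\le\frac12f(r,u)u$ for all $(r,u)\in[0,\infty)\times\mathbb{R}$. $(g_3)$ For every $u\in\mathbb{R}$, $F(\cdot,u)\in C^1(0,\infty)$ with $\partial_rF(r,u)\le0$ for all $r>0$. Then for every $\alpha\in\mathbb{R}$ there exists a unique radially symmetric solution $u=u(|x|)$, $u\in C^2([0,\infty),\mathbb{R})$, of $$-\Delta u-k^2u=f(|x|,u),\qquad x\in\mathbb{R}^N,$$ satisfying $u(0)=\alpha$ and $u'(0)=0$. Moreover, $$\sup_{r\ge1}\left\{r^{N-1}\bigl(u'(r)^2+u(r)^2\bigr)\right\}<\infty,$$ so that, identifying $u(x)$ with $u(|x|)$ for $x\in\mathbb{R}^N$, we have $\frac{u}{\sqrt{1+|x|^2}},\ \frac{|\nabla u|}{\sqrt{1+|x|^2}}\in L^2(\mathbb{R}^N)$. If, in addition, $(g_4)$ $f(r,u)=o(|u|)$ as $u\to0$, uniformly in $r>0$, then $u$ satisfies the asymptotic conditions $$u(x)=O(|x|^{\frac{1-N}{2}})\quad\text{and}\quad\frac{\partial^2u}{\partial r^2}(x)+k^2u(x)=o(|x|^{\frac{1-N}{2}})\quad\text{as }r=|x|\to\inf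ty.$$
   Context: For a radial function $u=u(r)$, $r=|x|$, the equation is equivalent to the ordinary differential equation $-u''-\frac{N-1}{r}u'-k^2u=f(r,u)$ for $r>0$. *)

(* Defs.v *)
From HB Require Import structures.
From mathcomp Require Import all_boot all_order all_algebra.
From mathcomp Require Import all_classical all_reals all_analysis.
Set Implicit Arguments.
Unset Strict Implicit.
Unset Printing Implicit Defensive.
Import Order.TTheory GRing.Theory Num.Theory.
Import numFieldNormedType.Exports.
Local Open Scope classical_set_scope.
Local Open Scope ring_scope.

(** Functions on [0, +oo[ are total functions on R of which only the values at
    nonnegative arguments are used.  Derivatives are relative to [0, +oo[: the
    increments range over points of the half-line, so that the derivative is
    one-sided at 0. *)
Section half_line.
Context {R : realType}.
Implicit Types (u : R -> R) (r : R).

Definition half_line : set R := [set r | 0 <= r].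

Definition half_quotient u r : R -> R := fun s => (u s - u r) / (s - r).

Definition half_derivable u r : Prop :=
  cvg (half_quotient u r @ within half_line r^').

Definition half_derive u r : R :=
  lim (half_quotient u r @ within half_line r^').

Definition half_derive2 u : R -> R := half_derive (half_derive u).

Definition C2_half_line u : Prop :=
  [/\ forall r, 0 <= r -> half_derivable u r,
      forall r, 0 <= r -> half_derivable (half_derive u) r &
      {within half_line, continuous (half_derive2 u)}].

End half_line.

Section euclidean_space.
Context {R : realType} {N : nat}.
Implicit Types (x : 'rV[R]_N) (g : 'rV[R]_N -> R) (u : R -> R).

(** The library norm on row vectors is the sup norm. *)
Definition enorm x : R := Num.sqrt (\sum_(i < N) x 0 i ^+ 2).

Definition partial (i : 'I_N) g : 'rV[R]_N -> R :=
  fun x => 'D_(delta_mx 0 i) g x.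

Definition laplacian g : 'rV[R]_N -> R :=
  fun x => \sum_(i < N) partial i (partial i g) x.

Definition grad_norm g : 'rV[R]_N -> R :=
  fun x => Num.sqrt (\sum_(i < N) partial i g x ^+ 2).

Definition radial u : 'rV[R]_N -> R := fun x => u (enorm x).

(** The filter |x| -> +oo. *)
Definition at_infinity : set_system 'rV[R]_N :=
  filter_from [set: R] (fun M => [set x | M < enorm x]).

Global Instance at_infinity_filter : Filter at_infinity.
Proof.
apply: filter_from_filter; first by exists 0.
move=> M1 M2 _ _; exists (Num.max M1 M2) => // x /=.
by rewrite gt_max => /andP[].
Qed.

Canonical at_infinity_filter_on := FilterType at_infinity at_infinity_filter.

End euclidean_space.

Section nonlinearity.
Context {R : realType}.
Implicit Types (g : R -> R) (f : R -> R -> R).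

(** The oriented integral from a to b. *)
Definition oriented_int g (a b : R) : R :=
  if a <= b then \int[lebesgue_measure]_(s in `[a, b]) g s
  else - \int[lebesgue_measure]_(s in `[b, a]) g s.

Definition primitive f (r u : R) : R := oriented_int (f r) 0 u.

(** Locally Lipschitz in u in the sense of ODE theory: the Lipschitz constant
    is uniform for r near any given point of the half-line. *)
Definition locally_lipschitz_snd f : Prop :=
  forall r0 u0 : R, 0 <= r0 ->
  exists2 e : R, 0 < e & exists L : R, forall r u v : R,
    0 <= r -> `|r - r0| < e -> `|u - u0| < e -> `|v - u0| < e ->
    `|f r u - f r v| <= L * `|u - v|.

Definition assumption_g1 f : Prop :=
  [/\ {within [set p : R * R | 0 <= p.1],
        continuous (fun p : R * R => f p.1 p.2)},
      forall r : R, 0 <= r -> f r 0 = 0 &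
      locally_lipschitz_snd f].

Definition assumption_g2 f : Prop :=
  forall r u : R, 0 <= r ->
    0 <= primitive f r u /\ primitive f r u <= 2^-1 * (f r u * u).

Definition assumption_g3 f : Prop :=
  forall u : R,
  [/\ forall r : R, 0 < r -> derivable (fun s : R => primitive f s u) r 1,
      forall r : R, 0 < r ->
        {for r, continuous (derive1 (fun s : R => primitive f s u))} &
      forall r : R, 0 < r -> derive1 (fun s : R => primitive f s u) r <= 0].

Definition assumption_g4 f : Prop :=
  forall e : R, 0 < e -> exists2 d : R, 0 < d &
    forall r u : R, 0 < r -> `|u| < d -> `|f r u| <= e * `|u|.

(** A radial solution x |-> u |x| on the whole of R^N, origin included.  The
    directional derivatives in the Laplacian all exist as soon as u is C^2 on
    [0, +oo[ with u'(0) = 0. *)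
Definition radial_solution (N : nat) (k : R) f u : Prop :=
  C2_half_line u /\
  forall x : 'rV[R]_N,
    - laplacian (radial u) x - k ^+ 2 * radial u x = f (enorm x) (radial u x).

Definition radial_solution_ivp (N : nat) (k : R) f (a : R) u : Prop :=
  [/\ radial_solution N k f u, u 0 = a & half_derive u 0 = 0].

End nonlinearity.

(** Lebesgue measure on R^n (as n-tuples), by iterated products; the
    sigma-algebra is the Borel one, generated by the coordinates. *)
Section lebesgue_cons.
Context {R : realType} {n : nat}.
Local Notation RT := (measurableTypeR R).

Definition cons_pair (p : RT * n.-tuple RT) : n.+1.-tuple RT :=
  [tuple of p.1 :: p.2].

Lemma measurable_cons_pair : measurable_fun [set: RT * n.-tuple RT] cons_pair.
Proof. exact: measurable_cons. Qed.

HB.instance Definition _ := isMeasurableFun.Build _ _ _ _ cons_pair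
  measurable_cons_pair.

Variable mu : {sigma_finite_measure set (n.-tuple RT) -> \bar R}.

Definition lebesgue_cons : set (n.+1.-tuple RT) -> \bar R :=
  pushforward (lebesgue_measure \x mu)%E cons_pair.

Let lebesgue_cons0 : lebesgue_cons set0 = 0%E.
Proof. by rewrite /lebesgue_cons /pushforward preimage_set0 measure0. Qed.

Let lebesgue_cons_ge0 A : (0 <= lebesgue_cons A)%E.
Proof. exact: measure_ge0. Qed.

Let lebesgue_cons_sigma_additive : semi_sigma_additive lebesgue_cons.
Proof.
by apply: measure_semi_sigma_additive.
Qed.

HB.instance Definition _ := isMeasure.Build _ _ _ lebesgue_cons
  lebesgue_cons0 lebesgue_cons_ge0 lebesgue_cons_sigma_additive.

Let uncons (t : n.+1.-tuple RT) : RT * n.-tuple RT :=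
  (thead t, [tuple of behead t]).

Let measurable_uncons : measurable_fun [set: n.+1.-tuple RT] uncons.
Proof.
apply/measurable_fun_pairP; split.
  exact: (measurable_tnth (ord0 : 'I_n.+1)).
exact: measurable_behead.
Qed.

Let cons_pairK : cancel cons_pair uncons.
Proof. by move=> [x t]; congr (_, _); apply: val_inj. Qed.

Let lebesgue_cons_sigma_finite : sigma_finite setT lebesgue_cons.
Proof.
have /sigma_finiteP[F [TF ndF Foo]] := sigma_finiteT (@lebesgue_measure R).
have /sigma_finiteP[G [TG ndG Goo]] := sigma_finiteT mu.
exists (fun i => uncons @^-1` (F i `*` G i)).
  rewrite -preimage_bigcup (_ : \bigcup_i _ = setT) ?preimage_setT//.
  rewrite -subTset => -[x t] _.
  have [i _ Fx] : (\bigcup_i F i) x by rewrite -TF.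
  have [j _ Gt] : (\bigcup_i G i) t by rewrite -TG.
  exists (maxn i j) => //; split => /=.
    by move: Fx; exact/subsetPset/ndF/leq_maxl.
  by move: Gt; exact/subsetPset/ndG/leq_maxr.
move=> i; have [mF Fi] := Foo i; have [mG Gi] := Goo i; split.
  rewrite -[X in measurable X]setTI; apply: measurable_uncons => //.
  exact: measurableX.
rewrite /lebesgue_cons /pushforward -comp_preimage.
rewrite (_ : uncons \o cons_pair = id); last first.
  by apply/funext => p /=; exact: cons_pairK.
by rewrite preimage_id product_measure1E// lte_mul_pinfty// ge0_fin_numE.
Qed.

HB.instance Definition _ := Measure_isSigmaFinite.Build _ _ _ lebesgue_cons
  lebesgue_cons_sigma_finite.

End lebesgue_cons.

Section lebesgue_tuple.
Context {R : realType}.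
Local Notation RT := (measurableTypeR R).

Fixpoint lebesgue_tuple (n : nat) :
    {sigma_finite_measure set (n.-tuple RT) -> \bar R} :=
  match n with
  | 0 => \d_([tuple] : 0.-tuple RT)
  | m.+1 => lebesgue_cons (lebesgue_tuple m)
  end.

Lemma lebesgue_tuple_box n (a b : 'I_n -> R) :
  (forall i, a i <= b i) ->
  lebesgue_tuple n [set t | forall i, a i <= tnth t i <= b i] =
  (\prod_(i < n) (b i - a i))%:E.
Proof.
elim: n a b => [|n IH] a b ab.
  by rewrite big_ord0 /= diracE mem_set // => -[].
rewrite big_ord_recl EFinM -IH//= /lebesgue_cons /pushforward.
have mbox : measurable [set t : n.-tuple RT |
    forall i, a (lift ord0 i) <= tnth t i <= b (lift ord0 i)].
  rewrite (_ : mkset _ = \bigcap_(i in [set: 'I_n])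
    ((fun t : n.-tuple RT => tnth t i) @^-1`
      `[a (lift ord0 i), b (lift ord0 i)])); last first.
    by apply/seteqP; split => t /= H i; [move=> _|have := H i I];
      rewrite /= in_itv /=; [exact: H|].
  apply: fin_bigcap_measurable => // i _.
  by rewrite -[X in measurable X]setTI; apply: measurable_tnth.
rewrite (_ : _ @^-1` _ = `[a ord0, b ord0]%classic `*` [set t : n.-tuple RT |
    forall i, a (lift ord0 i) <= tnth t i <= b (lift ord0 i)]).
  rewrite product_measure1E//= lebesgue_measure_itv /= lte_fin.
  case: ltP => [//|ba]; have -> : b ord0 = a ord0 by apply/le_anti; rewrite ba ab.
  by rewrite subrr.
apply/seteqP; split => -[x t] /=; rewrite in_itv /=.
  move=> H; split=> [|i]; first exact: (H ord0).
  by have := H (lift ord0 i); rewrite tnthS.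
by move=> [Hx Ht] i; case: (unliftP ord0 i) => [j ->|->//]; rewrite tnthS.
Qed.

End lebesgue_tuple.

Section L2.
Context {R : realType}.

Definition tuple_row (n : nat) (t : n.-tuple R) : 'rV[R]_n :=
  \row_(i < n) tnth t i.

(** Square integrable functions on R^n. *)
Definition in_L2 (n : nat) (g : 'rV[R]_n -> R) : Prop :=
  (g \o @tuple_row n : n.-tuple (measurableTypeR R) -> R)
    \in Lfun (lebesgue_tuple n) 2%:E.

End L2.

(* Main.v *)
Require Import Defs.
From HB Require Import structures.
From mathcomp Require Import all_boot all_order all_algebra.
From mathcomp Require Import all_classical all_reals all_analysis.
From mathcomp Require Import measurable_realfun ring lra.
Set Implicit Arguments.
Unset Strict Implicit.
Unset Printing Implicit Defensive.
Import Order.TTheory GRing.Theory Num.Theory.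
Import numFieldNormedType.Exports.
Local Open Scope classical_set_scope.
Local Open Scope ring_scope.

(** With [m = N - 1] and [p = u'], the radial equation reads
    [(r^m p)' = - r^m (k^2 u + f (r, u))].  Truncating [f] in [u] makes it
    globally Lipschitz on bounded intervals, and Picard iteration converges in
    norms with an exponential weight.  By (g_3) the energy
    [p^2 / 2 + k^2 u^2 / 2 + F (r, u)] is nonincreasing, so the truncation is
    never felt.  Applied to [r^m ((p + m u / (2 r))^2 / 2 + k^2 u^2 / 2 + F)],
    the same argument, together with (g_2), bounds [r^m (p^2 + u^2)], from which
    the L2 and asymptotic statements follow. *)

(** The shift in the second energy is the Liouville substitution: for [v = r^(m/2) u] one has
    [v' = r^(m/2) q] with [q = p + m u / (2 r)], and the first-order term of the equation
    disappears, leaving a perturbation of size [u / r^2]. Its integrability at infinity makes the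
    bound uniform in [r]. The growing weight [r^m] in front of [F] is paid for by (g_2), in the form
    [2 F <= f u].

    The origin is the delicate point. (g_3) gives monotonicity for [r > 0] only, so energies start
    at a small [t > 0], and as [t] tends to 0 the term [F (t, u t)] is replaced by its upper bound
    [f u / 2], which is continuous up to 0. The coefficient [m / r] is singular there, so the
    equation is kept in divergence form and [u''(0)] is read off from the flux [r^m p].

    Functions on the half-line are extended evenly through [|r|]: continuity then holds on the whole
    line, while derivatives are asserted for [r > 0] only. *)

Section calculus.
Context {R : realType}.
Implicit Types (f g df dg : R -> R) (a b c x : R).

Lemma is_derive_continuous f (l : R) x : is_derive x 1 f l -> {for x, continuous f}.
Proof. by move=> d; apply/differentiable_continuous/derivable1_diffP. Qed.

Lemma ge0_derive_le f df a b : a <= b -> continuous f ->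
  (forall x, a < x -> x < b -> is_derive x 1 f (df x)) ->
  (forall x, a < x -> x < b -> 0 <= df x) -> f a <= f b.
Proof.
move=> ab cf fdf df0; case: ltgtP ab => // [ab _|-> //].
have [x|c] := MVT ab _ (continuous_subspaceT cf) (df := df).
  by rewrite in_itv/= => /andP[]; exact: fdf.
rewrite in_itv/= => /andP[ac cb] e; rewrite -subr_ge0 e mulr_ge0 ?df0//.
by rewrite subr_ge0 ltW.
Qed.

Lemma derive_le f g df dg a b : a <= b -> continuous f -> continuous g ->
  (forall x, a < x -> x < b -> is_derive x 1 f (df x)) ->
  (forall x, a < x -> x < b -> is_derive x 1 g (dg x)) ->
  (forall x, a < x -> x < b -> df x <= dg x) ->
  f a <= g a -> f b <= g b.
Proof.
move=> ab cf cg fd gd le fga; rewrite -subr_ge0.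
have /(le_trans _) : (g - f) a <= (g - f) b; last first.
  by apply; rewrite subr_ge0.
apply: (@ge0_derive_le _ (fun x => dg x - df x)) => //.
- by move=> x; apply: continuousB; [exact: cg|exact: cf].
- move=> x ax xb; have ? := fd x ax xb; have ? := gd x ax xb.
  exact: is_deriveB.
- by move=> x ax xb; rewrite subr_ge0 le.
Qed.

(** This comparison principle replaces the estimation of integrals below: to bound an
    antiderivative, an explicit majorant is differentiated. *)
Lemma norm_derive_le f g df dg a b : a <= b -> continuous f -> continuous g ->
  (forall x, a < x -> x < b -> is_derive x 1 f (df x)) ->
  (forall x, a < x -> x < b -> is_derive x 1 g (dg x)) ->
  (forall x, a < x -> x < b -> `|df x| <= dg x) ->
  `|f a| <= g a -> `|f b| <= g b.
Proof.
move=> ab cf cg fd gd le; rewrite !ler_norml => /andP[fa1 fa2].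
apply/andP; split; last first.
  apply: (derive_le ab cf cg fd gd) => // x ax xb.
  exact: le_trans (ler_norm _) (le x ax xb).
rewrite lerNl.
apply: (@derive_le (- f) g (fun x => - df x) dg a b) => //.
- by move=> x; apply: continuousN; exact: cf.
- by move=> x ax xb; have ? := fd x ax xb; exact: is_deriveN.
- move=> x ax xb; rewrite (le_trans _ (le x ax xb))//.
  by rewrite -normrN ler_norm.
- by rewrite /= lerNl.
Qed.

Lemma continuous_itv_integrable g a b : continuous g ->
  lebesgue_measure.-integrable `[a, b] (EFin \o g).
Proof.
move=> cg; apply: continuous_compact_integrable; first exact: segment_compact.
exact: continuous_subspaceT.
Qed.

Lemma oriented_int_split g c a y : continuous g -> c < a -> c < y ->
  oriented_int g a y = \int[lebesgue_measure]_(s in `[c, y]) g s -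
                       \int[lebesgue_measure]_(s in `[c, a]) g s.
Proof.
move=> cg ca cy; rewrite /oriented_int.
have H u v : c < u -> u <= v -> \int[lebesgue_measure]_(s in `[u, v]) g s =
    \int[lebesgue_measure]_(s in `[c, v]) g s -
    \int[lebesgue_measure]_(s in `[c, u]) g s.
  move=> cu uv; rewrite Rintegral_itvB ?bnd_simp ?(ltW cu)//; last first.
    exact: continuous_itv_integrable.
  rewrite Rintegral_itv_obnd_cbnd//.
  apply: integrableS (continuous_itv_integrable u v cg) => //.
  by apply: subset_itvr; rewrite bnd_simp.
by case: leP => ay; rewrite H// ?opprB// ltW.
Qed.

Lemma is_derive_oriented_int g a x : continuous g ->
  is_derive x 1 (oriented_int g a) (g x).
Proof.
(* A base point strictly below both [a] and [x] removes the case distinction in the oriented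
   integral and puts [x] in the interior of the domain of integration. *)
move=> cg; pose c := Num.min a x - 1.
have ca : c < a by rewrite /c ltrBlDr (@le_lt_trans _ _ a)// ?ltrDl// ge_min lexx.
have cx : c < x by rewrite /c ltrBlDr (@le_lt_trans _ _ x)// ?ltrDl// ge_min lexx orbT.
pose G := (fun y => \int[lebesgue_measure]_(s in `[c, y]) g s).
have [dG eG] : derivable G x 1 /\ derive1 G x = g x.
  apply: (@continuous_FTC1_closed R g c x (x + 1)) => //.
  - by rewrite ltrDl.
  - exact: continuous_itv_integrable.
  - exact: cg.
apply: (@near_eq_is_derive _ _ _ (fun y => G y - G a)).
  near=> y; rewrite (@oriented_int_split g c)//.
  by near: y; exact: lt_nbhsr.
have ? : is_derive x 1 G (g x) by apply: DeriveDef => //; rewrite -derive1E.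
by apply: is_derive_eq; rewrite subr0.
Unshelve. all: by end_near. Qed.

Lemma oriented_intxx g a : oriented_int g a a = 0.
Proof. by rewrite /oriented_int lexx set_itv1 Rintegral_set1. Qed.

(** Continuous induction: the supremum of the [t] such that [P] holds on [[a, t]] is attained by the
    left-hand hypothesis, and passed by the right-hand one unless it is [b]. *)
Lemma interval_ind (P : R -> Prop) a b : a <= b -> P a ->
  (forall c, a < c -> c <= b -> (forall s, a <= s -> s < c -> P s) -> P c) ->
  (forall c, a <= c -> c < b -> (forall s, a <= s -> s <= c -> P s) ->
    \forall s \near c^'+, P s) ->
  forall s, a <= s -> s <= b -> P s.
Proof.
move=> ab Pa Pl Pr.
pose A := [set t | a <= t <= b /\ forall s, a <= s -> s <= t -> P s].
have Aa : A a.
  split; first by rewrite lexx.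
  by move=> s as_ sa; rewrite (_ : s = a)//; apply/le_anti; rewrite sa as_.
have supA : has_sup A by split; [exists a|exists b => t [/andP[]]].
pose c := sup A.
have ac : a <= c by exact: (ub_le_sup supA.2 Aa).
have cb : c <= b by by apply: ge_sup => [|t [/andP[]]]; [exists a|].
have Pc s : a <= s -> s < c -> P s.
  move=> as_ sc; have cs : 0 < c - s by rewrite subr_gt0.
  have [t At] := sup_adherent cs supA.
  by rewrite -/c subKr => st; apply: At.2 => //; exact: ltW.
have Pc' s : a <= s -> s <= c -> P s.
  move=> as_; rewrite le_eqVlt => /orP[/eqP sc|]; last exact: Pc.
  move: as_ (sc) => /[swap] ->; rewrite le_eqVlt => /orP[/eqP <-//|ac'].
  exact: Pl.
case: (ltgtP c b) cb => // [cb _|cb _]; last by rewrite -cb.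
exfalso.
have [d /= d0 H] := Pr c ac cb Pc'.
pose e := Num.min (d / 2) (b - c).
have e0 : 0 < e by rewrite lt_min divr_gt0//= subr_gt0.
have ed : e <= d / 2 by rewrite ge_min lexx.
have eb : e <= b - c by rewrite ge_min lexx orbT.
have : A (c + e).
  split; first by apply/andP; split; lra.
  move=> s as_ sc; have [/(Pc' s as_)//|cs] := leP s c.
  apply: H => //=; rewrite ltr_norml; apply/andP; split; lra.
by move/(ub_le_sup supA.2); rewrite -/c; lra.
Qed.

(** The right-hand condition bounds the upper right Dini derivative by 0; the left-hand one, lower
    semicontinuity from the left, forbids upward jumps. Continuous induction proves the bound with
    an arbitrarily small slope [d]; the [+ 1] in its denominator covers [a = b]. *)
Lemma dini_le g a b : a <= b ->
  (forall c e, a <= c -> c < b -> 0 < e ->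
    \forall s \near c^'+, g s <= g c + e * (s - c)) ->
  (forall c e, a < c -> c <= b -> 0 < e ->
    \forall s \near c^'-, g c <= g s + e) ->
  g b <= g a.
Proof.
move=> ab Hr Hl; apply/ler_addgt0Pr => e e0.
pose d := e / (b - a + 1).
have d0 : 0 < d by rewrite divr_gt0//; lra.
suff : g b <= g a + d * (b - a).
  move=> /le_trans; apply; rewrite lerD2l /d mulrAC ler_pdivrMr; nra.
apply: (@interval_ind (fun s => g s <= g a + d * (s - a)) a b) => //.
- by rewrite subrr mulr0 addr0.
- move=> c ac cb H; apply/ler_addgt0Pr => n n0.
  near (c^'-) => s.
  have sc : s < c by near: s; exact: nbhs_left_lt.
  have as_ : a < s by near: s; exact: nbhs_left_gt.
  have : g c <= g s + n by near: s; exact: Hl.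
  by have := H s (ltW as_) sc; nra.
- move=> c ac cb H; near=> s.
  have : g s <= g c + d * (s - c) by near: s; exact: Hr.
  by have := H c ac (lexx _); nra.
Unshelve. all: by end_near. Qed.

(** The sequence [g n = 2 C 2^-n] has decrements [C 2^-n], so [x - g] is nondecreasing and [x + g]
    nonincreasing. They squeeze the limit, which gives convergence and rate at once. *)
Lemma geometric_cvg (x : nat -> R) (C : R) :
  (forall n, `|x n.+1 - x n| <= C * 2^-1 ^+ n) ->
  cvgn x /\ forall n, `|limn x - x n| <= 2 * C * 2^-1 ^+ n.
Proof.
move=> H.
pose g := geometric (2 * C) (2^-1 : R).
have g0 : g n @[n --> \oo] --> 0.
  by apply: cvg_geometric; rewrite ger0_norm ?invr_ge0// invf_lt1 ?ltr1n.
have C0 : 0 <= C.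
  by have := le_trans (normr_ge0 _) (H 0%N); rewrite expr0 mulr1.
have ndy : nondecreasing_seq (x \- g).
  apply/nondecreasing_seqP => n; rewrite /g /geometric/= exprS.
  by have := H n; rewrite ler_norml => /andP[]; lra.
have niz : nonincreasing_seq (x \+ g).
  apply/nonincreasing_seqP => n; rewrite /g /geometric/= exprS.
  by have := H n; rewrite ler_norml => /andP[]; lra.
have gge0 n : 0 <= g n by rewrite /g /geometric/= !mulr_ge0// exprn_ge0// invr_ge0.
have cy : cvgn (x \- g).
  apply: nondecreasing_is_cvgn => //; exists ((x \+ g) 0%N) => _ [n _ <-].
  apply: le_trans (niz 0%N n _) => //=.
  by have := gge0 n; lra.
have xE : x = (x \- g) \+ g by apply/funext => n /=; rewrite subrK.
have cx : cvgn x by rewrite xE; apply: is_cvgD => //; apply/cvg_ex; exists 0.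
have ly : limn (x \- g) = limn x.
  by rewrite (cvg_lim _ (cvgB cx g0))// subr0.
have cz : cvgn (x \+ g) by apply: is_cvgD => //; apply/cvg_ex; exists 0.
have lz : limn (x \+ g) = limn x.
  by rewrite (cvg_lim _ (cvgD cx g0))// addr0.
split => // n.
have := nondecreasing_cvgn_le ndy cy n; have := nonincreasing_cvgn_ge niz cz n.
rewrite ly lz /g /geometric/= => h1 h2.
rewrite ler_norml; apply/andP; split; lra.
Qed.

Lemma half_pow_small (C e : R) : 0 < e -> exists n, C * 2^-1 ^+ n <= e.
Proof.
move=> e0; have /cvgrPdist_le/(_ e e0)[n _ /(_ n (leqnn n))/=] :
    (fun n => C * 2^-1 ^+ n) n @[n --> \oo] --> 0.
  by apply: (@cvg_geometric _ C 2^-1); rewrite ger0_norm ?invr_ge0// invf_lt1 ?ltr1n.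
by rewrite sub0r normrN => /(le_trans (ler_norm _)); exists n.
Qed.

End calculus.
(* The library states the differentiation rules for the pointwise operations
   on functions; the lambda forms unify with formulas. *)
Section derivation_rules.
Context {R : realType}.
Implicit Types (f g : R -> R) (x k a b : R).

Lemma is_derive_fadd f g x a b : is_derive x 1 f a -> is_derive x 1 g b ->
  is_derive x 1 (fun s => f s + g s) (a + b).
Proof. by move=> ? ?; exact: is_deriveD. Qed.

Lemma is_derive_fopp f x a : is_derive x 1 f a ->
  is_derive x 1 (fun s => - f s) (- a).
Proof. by move=> ?; exact: is_deriveN. Qed.

Lemma is_derive_fmul f g x a b : is_derive x 1 f a -> is_derive x 1 g b ->
  is_derive x 1 (fun s => f s * g s) (a * g x + f x * b).
Proof.
move=> ? ?; have H := is_deriveM (f := f) (g := g) (x := x) (v := 1).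
by apply: is_derive_eq; rewrite /GRing.scale/= addrC; congr (_ + _); rewrite mulrC.
Qed.

Lemma is_derive_fexp f n x a : is_derive x 1 f a ->
  is_derive x 1 (fun s => f s ^+ n) (n%:R * f x ^+ n.-1 * a).
Proof.
move=> df; have := is_deriveX n df.
rewrite /GRing.scale/= => H; apply: near_eq_is_derive H.
by apply: filterE => y; rewrite exprfctE.
Qed.

Lemma is_derive_fcomp f g x a b : is_derive (g x) 1 f a -> is_derive x 1 g b ->
  is_derive x 1 (fun s => f (g s)) (a * b).
Proof. exact: is_derive1_comp. Qed.

Lemma is_derive_fV f x a : f x != 0 -> is_derive x 1 f a ->
  is_derive x 1 (fun s => (f s)^-1) (- (f x) ^- 2 * a).
Proof.
move=> fx0 df; apply: DeriveDef; first exact: derivableV.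
by rewrite deriveV// derive_val /GRing.scale/=.
Qed.

Lemma is_derive_fid x : is_derive x 1 (fun s : R => s) 1.
Proof. exact: is_derive_id. Qed.

Lemma is_derive_fcst k x : is_derive x 1 (fun _ : R => k) 0.
Proof. exact: is_derive_cst. Qed.

Lemma continuous_fadd f g : continuous f -> continuous g ->
  continuous (fun s => f s + g s).
Proof. by move=> cf cg x; apply: continuousD; [exact: cf|exact: cg]. Qed.

Lemma continuous_fopp f : continuous f -> continuous (fun s => - f s).
Proof. by move=> cf x; apply: continuousN; exact: cf. Qed.

Lemma continuous_fmul f g : continuous f -> continuous g ->
  continuous (fun s => f s * g s).
Proof. by move=> cf cg x; apply: continuousM; [exact: cf|exact: cg]. Qed.

Lemma continuous_fcomp f g : continuous f -> continuous g ->
  continuous (fun s => f (g s)).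
Proof. by move=> cf cg x; apply: continuous_comp; [exact: cg|exact: cf]. Qed.

Lemma continuous_fexp f n : continuous f -> continuous (fun s => f s ^+ n).
Proof.
move=> cf; apply: (@continuous_fcomp (fun s => s ^+ n)) => //.
exact: exprn_continuous.
Qed.

Lemma continuous_fexpR f : continuous f -> continuous (fun s => expR (f s)).
Proof. by apply: continuous_fcomp; exact: continuous_expR. Qed.

Lemma continuous_fcst k : continuous (fun _ : R => k).
Proof. by move=> x; exact: cvg_cst. Qed.

Lemma continuous_fid : continuous (fun s : R => s).
Proof. by move=> x; exact: cvg_id. Qed.

Lemma continuous_fnorm f : continuous f -> continuous (fun s => `|f s|).
Proof. by apply: continuous_fcomp; exact: norm_continuous. Qed.

End derivation_rules.

Ltac continuous_formula := repeat first
  [ eassumption | exact: continuous_fid | exact: continuous_fcst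
  | apply: continuous_fadd | apply: continuous_fopp | apply: continuous_fmul
  | apply: continuous_fexp | apply: continuous_fnorm
  | apply: continuous_fexpR ].

Ltac derive_formula := repeat first
  [ eassumption
  | notypeclasses refine (is_derive_fid _) | notypeclasses refine (is_derive_fcst _ _)
  | notypeclasses refine (is_derive_fadd _ _) | notypeclasses refine (is_derive_fopp _)
  | notypeclasses refine (is_derive_fmul _ _) | notypeclasses refine (is_derive_fexp _ _)
  | notypeclasses refine (is_derive_fcomp (is_derive_expR _) _) ].
(* Plain application would let class resolution guess the derivative. *)
Ltac derive_eq := notypeclasses refine (is_derive_eq _ _);
  [solve [derive_formula]|cbv beta].

(** * Inverting the radial operator [(r^m w')'] *)

Section radial_antiderivative.
Context {R : realType} (m : nat).
Hypothesis m0 : (0 < m)%N.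
Implicit Types (h p w q g u v : R -> R) (r s t : R).

Lemma is_derive_expRM (l x : R) :
  is_derive x 1 (fun s => expR (l * s)) (l * expR (l * x)).
Proof. by derive_eq; ring. Qed.

Lemma is_derive_exprn n (x : R) :
  is_derive x 1 (fun s => s ^+ n) (n%:R * x ^+ n.-1).
Proof. by derive_eq; rewrite mulr1. Qed.

(* The weight [expR (L + 1) s] makes the integral operator
   [g |-> - \int r^-m \int s^m g] a contraction of ratio [L / (L + 1)^2]. *)
Lemma radial_contraction w q g (T L D : R) :
  continuous w -> continuous q -> 0 <= L -> 0 <= D ->
  (forall r, 0 < r -> r < T -> is_derive r 1 w (q r)) ->
  (forall r, 0 < r -> r < T ->
    is_derive r 1 (fun s => s ^+ m * q s) (- (r ^+ m * g r))) ->
  w 0 = 0 ->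
  (forall s, 0 <= s -> s <= T -> `|g s| <= L * (D * expR ((L + 1) * s))) ->
  forall r, 0 <= r -> r <= T -> `|w r| <= D / 2 * expR ((L + 1) * r).
Proof.
move=> cw cq L0 D0 dw dq w0 gle.
set l := L + 1; have l0 : 0 < l by rewrite /l; lra.
(* The flux is compared with [s ^+ m * expR (l * s)], whose derivative has the wanted term
   [l * s ^+ m * expR (l * s)] plus a nonnegative one. Each of the two integrations gains a factor
   [1 / l]. *)
have hq r : 0 < r -> r <= T -> `|q r| <= L * D / l * expR (l * r).
  move=> r0 rT.
  have rm0 : 0 < r ^+ m by rewrite exprn_gt0.
  rewrite -(ler_pM2l rm0) mulrCA -{1}(gtr0_norm rm0) -normrM.
  apply: (@norm_derive_le _ (fun s => s ^+ m * q s)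
    (fun s => L * D / l * (s ^+ m * expR (l * s))) _
    (fun s => L * D / l * (m%:R * s ^+ m.-1 * expR (l * s) +
       s ^+ m * (l * expR (l * s)))) 0 r (ltW r0)).
  - by continuous_formula.
  - by continuous_formula.
  - by move=> x x0 xr; apply: dq => //; exact: lt_le_trans rT.
  - move=> x x0 xr.
    have ? := is_derive_exprn m x; have ? := is_derive_expRM l x.
    by derive_eq; ring.
  - move=> x x0 xr; have x0' := ltW x0; rewrite normrN normrM ger0_norm ?exprn_ge0//.
    apply: (@le_trans _ _ (x ^+ m * (L * (D * expR (l * x))))).
      by rewrite ler_pM2l ?exprn_gt0// gle// ltW// (lt_le_trans xr).
    rewrite mulrDr -[leLHS]add0r lerD//.
      by have l0' := ltW l0; rewrite !mulr_ge0// ?invr_ge0 ?exprn_ge0 ?expR_ge0.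
    rewrite le_eqVlt; apply/orP; left; apply/eqP; field.
    by rewrite gt_eqF.
  - by rewrite expr0n eqn0Ngt m0/= !mul0r normr0 mulr0.
move=> r r0 rT.
have H : `|w r| <= L * D / l / l * expR (l * r).
  apply: (@norm_derive_le _ w (fun s => L * D / l / l * expR (l * s)) q
    (fun s => L * D / l / l * (l * expR (l * s))) 0 r) => //.
  - by continuous_formula.
  - by move=> x x0 xr; apply: dw => //; exact: lt_le_trans rT.
  - move=> x x0 xr; have ? := is_derive_expRM l x.
    by derive_eq; ring.
  - move=> x x0 xr; rewrite mulrA divfK ?gt_eqF//.
    by apply: hq => //; apply: ltW; apply: lt_le_trans rT.
  - by have l0' := ltW l0; rewrite w0 normr0 !mulr_ge0// ?invr_ge0 ?expR_ge0.
apply: (le_trans H); rewrite ler_wpM2r ?expR_ge0//.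
rewrite ler_pdivrMr// ler_pdivrMr// /l.
(* The ratio is at most one half because [2 L <= (L + 1)^2]. *)
rewrite (_ : D / 2 * _ * _ = D * ((L + 1) ^+ 2 / 2)); last by field.
by rewrite mulrC ler_wpM2l//; nra.
Qed.

(** The problem solved by [u - v] is linear with zero initial value. Taken for two images of the
    Picard map this gives existence, taken for two solutions it gives uniqueness. *)
Lemma radial_contraction2 u v p q g h (T L D : R) :
  continuous u -> continuous v -> continuous p -> continuous q ->
  0 <= L -> 0 <= D ->
  (forall r, 0 < r -> r < T -> is_derive r 1 u (p r)) ->
  (forall r, 0 < r -> r < T -> is_derive r 1 v (q r)) ->
  (forall r, 0 < r -> r < T ->
    is_derive r 1 (fun s => s ^+ m * p s) (- (r ^+ m * g r))) ->
  (forall r, 0 < r -> r < T ->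
    is_derive r 1 (fun s => s ^+ m * q s) (- (r ^+ m * h r))) ->
  u 0 = v 0 ->
  (forall s, 0 <= s -> s <= T ->
    `|g s - h s| <= L * (D * expR ((L + 1) * s))) ->
  forall r, 0 <= r -> r <= T -> `|u r - v r| <= D / 2 * expR ((L + 1) * r).
Proof.
move=> cu cv cp cq L0 D0 du dv dp dq uv0 gh r r0 rT.
apply: (@radial_contraction (fun s : R => u s + - v s) (fun s : R => p s + - q s)
  (fun s => g s - h s) T L D) => //.
- exact: (continuous_fadd cu (continuous_fopp cv)).
- exact: (continuous_fadd cp (continuous_fopp cq)).
- move=> s s0 sT; apply: is_derive_fadd; first exact: du.
  by apply: is_derive_fopp; exact: dv.
- move=> s s0 sT; have := dp s s0 sT; have := dq s s0 sT => ? ?.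
  apply: (@near_eq_is_derive _ _ _ (fun s : R => s ^+ m * p s + - (s ^+ m * q s))).
    by apply: filterE => t; ring.
  by derive_eq; ring.
- by rewrite uv0 subrr.
Qed.

(* Taken at [|t|], so that it is continuous on the whole line. *)
Definition radial_avg h (t : R) : R :=
  `|t| ^- m * oriented_int (fun s => s ^+ m * h s) 0 `|t|.

Lemma continuous_weight h : continuous h -> continuous (fun s : R => s ^+ m * h s).
Proof. by move=> ch; continuous_formula. Qed.

Lemma continuous_oriented_int h a : continuous h -> continuous (oriented_int h a).
Proof.
by move=> ch x; exact: is_derive_continuous (is_derive_oriented_int a x ch).
Qed.

Lemma radial_avg0 h : radial_avg h 0 = 0.
Proof. by rewrite /radial_avg normr0 oriented_intxx mulr0. Qed.

(** The majorant [B s^(m+1)] of the integral is cruder than needed by a factor [m + 1], but the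
    bound linear in [|t|] is what makes the average continuous at 0 with value 0, that is
    [u'(0) = 0]. *)
Lemma radial_avg_le h (B t : R) : continuous h ->
  (forall s, 0 <= s -> s <= `|t| -> `|h s| <= B) -> `|radial_avg h t| <= B * `|t|.
Proof.
move=> ch hB; have [->|t0] := eqVneq t 0; first by rewrite radial_avg0 !normr0 mulr0.
have {}t0 : 0 < `|t| by rewrite normr_gt0.
have B0 : 0 <= B by apply: le_trans (hB 0 _ _) => //; exact: ltW.
rewrite /radial_avg normrM normfV normrX normr_id mulrC ler_pdivrMr ?exprn_gt0//.
rewrite -mulrA -exprS.
apply: (@norm_derive_le _ (oriented_int (fun s => s ^+ m * h s) 0)
  (fun s => B * s ^+ m.+1) (fun s => s ^+ m * h s)
  (fun s => B * (m.+1%:R * s ^+ m)) 0) => //.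
- by apply: continuous_oriented_int; exact: continuous_weight.
- by continuous_formula.
- by move=> x _ _; exact/is_derive_oriented_int/continuous_weight.
- move=> x _ _; have ? := is_derive_exprn m.+1 x.
  by derive_eq; ring.
- move=> x x0 xt; have x0' := ltW x0; rewrite normrM ger0_norm ?exprn_ge0// mulrC.
  rewrite ler_pM ?exprn_ge0//; last first.
  - by rewrite ler_peMl ?exprn_ge0// ler1n.
  - by apply: hB; exact: ltW.
- by rewrite oriented_intxx normr0 expr0n mulr0.
Qed.

Lemma continuous_radial_avg h : continuous h -> continuous (radial_avg h).
Proof.
move=> ch x; have [->|x0] := eqVneq x 0; last first.
  apply: (@continuousM R R (fun t => `|t| ^- m)
    (fun t => oriented_int (fun s => s ^+ m * h s) 0 `|t|)).
    apply: (@continuousV R R (fun t => `|t| ^+ m)); first by rewrite expf_neq0// normr_eq0.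
    by apply: (_ : continuous (fun t : R => `|t| ^+ m)); continuous_formula.
  apply: (@continuous_fcomp _ (oriented_int _ 0) Num.norm); last by continuous_formula.
  by apply: continuous_oriented_int; exact: continuous_weight.
apply/cvgrPdist_le; rewrite radial_avg0 => e e0.
have /cvgrPdist_le/(_ 1 ltr01)[d /= d0 hd] := ch 0.
have B0 : 0 < `|h 0| + 1 by rewrite ltr_wpDl.
near=> t; rewrite sub0r normrN.
have td : `|t| < d.
  by near: t; exists d => //= t /=; rewrite sub0r normrN.
have hB s : 0 <= s -> s <= `|t| -> `|h s| <= `|h 0| + 1.
  move=> s0 st; have : `|h 0 - h s| <= 1.
    apply: hd => /=; rewrite sub0r normrN ger0_norm// (le_lt_trans st)//.
  by move=> ?; rewrite -lerBlDl (le_trans (lerB_dist _ _))// distrC.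
apply: le_trans (radial_avg_le ch hB) _.
rewrite mulrC -ler_pdivlMr//; near: t.
have de : 0 < e / (`|h 0| + 1) by rewrite divr_gt0.
by exists (e / (`|h 0| + 1)) => //= t /=; rewrite sub0r normrN => /ltW.
Unshelve. all: by end_near. Qed.

Lemma is_derive_radial_avg h (r : R) : continuous h -> 0 < r ->
  is_derive r 1 (fun s => s ^+ m * radial_avg h s) (r ^+ m * h r).
Proof.
move=> ch r0; apply: near_eq_is_derive (is_derive_oriented_int 0 r (continuous_weight ch)).
near=> s; have s0 : 0 < s by near: s; exact: lt_nbhsr.
rewrite /radial_avg gtr0_norm// mulrA divff ?mul1r//.
by rewrite expf_neq0// gt_eqF.
Unshelve. all: by end_near. Qed.

End radial_antiderivative.

(** * Picard iteration for a nonlinearity Lipschitz in [u] *)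

Section picard.
Context {R : realType} (m : nat).
Hypothesis m0 : (0 < m)%N.
Variables (hh : R -> R -> R) (a : R).
Hypothesis chh : continuous (fun p : R * R => hh p.1 p.2).
Hypothesis lip : forall T : R, exists2 L : R, 0 <= L & forall r u v : R,
  0 <= r -> r <= T -> `|hh r u - hh r v| <= L * `|u - v|.
Implicit Types (u v : R -> R) (r s t x y : R).

Lemma continuous_superposition u : continuous u -> continuous (fun s => hh s (u s)).
Proof.
move=> cu x; apply: (@continuous_comp _ _ _ (fun s => (s, u s))
  (fun p : R * R => hh p.1 p.2)); last exact: chh.
exact: (cvg_pair (cvg_id (F := nbhs x)) (cu x)).
Qed.

Let avg u := radial_avg m (fun s => hh s (u s)).
(** The Picard map: [w = step u] is the twice integrated form of [(r^m w')' = - r^m hh (r, u)] with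
    [w 0 = a], and [- avg u] is its derivative for [r > 0]. *)
Let step u (r : R) := a - oriented_int (avg u) 0 `|r|.
Let iter_ n := iter n step (fun=> a).

Let continuous_avg u : continuous u -> continuous (avg u).
Proof. by move=> cu; exact/continuous_radial_avg/continuous_superposition. Qed.

Let continuous_step u : continuous u -> continuous (step u).
Proof.
move=> cu; apply: continuous_fadd; first exact: continuous_fcst.
apply: continuous_fopp; apply: (@continuous_fcomp _ (oriented_int _ 0) Num.norm).
  exact/continuous_oriented_int/continuous_avg.
exact: (continuous_fnorm continuous_fid).
Qed.

Let is_derive_step u r : continuous u -> 0 < r ->
  is_derive r 1 (step u) (- avg u r).
Proof.
move=> cu r0.
have ? := is_derive_oriented_int 0 r (continuous_avg cu).
apply: (@near_eq_is_derive _ _ _ (fun s => a + - oriented_int (avg u) 0 s)).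
  by near=> s; rewrite /step gtr0_norm//; near: s; exact: lt_nbhsr.
by derive_eq; rewrite add0r.
Unshelve. all: by end_near. Qed.

Let flux_step u r : continuous u -> 0 < r ->
  is_derive r 1 (fun s => s ^+ m * - avg u s) (- (r ^+ m * hh r (u r))).
Proof.
move=> cu r0; have d := is_derive_radial_avg m (continuous_superposition cu) r0.
apply: near_eq_is_derive (is_derive_fopp d).
by apply: filterE => s; rewrite mulrN.
Qed.

Let step0 u : step u 0 = a.
Proof. by rewrite /step normr0 oriented_intxx subr0. Qed.

Let step_norm u r : step u `|r| = step u r.
Proof. by rewrite /step normr_id. Qed.

Let step_contraction u v (T L D : R) : continuous u -> continuous v ->
  0 <= L -> 0 <= D ->
  (forall r u v : R, 0 <= r -> r <= T -> `|hh r u - hh r v| <= L * `|u - v|) ->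
  (forall s, 0 <= s -> s <= T -> `|u s - v s| <= D * expR ((L + 1) * s)) ->
  forall r, 0 <= r -> r <= T ->
    `|step u r - step v r| <= D / 2 * expR ((L + 1) * r).
Proof.
move=> cu cv L0 D0 HL uv r r0 rT.
refine (@radial_contraction2 _ m m0 (step u) (step v) (fun s => - avg u s)
  (fun s => - avg v s) (fun s => hh s (u s)) (fun s => hh s (v s)) T L D
  _ _ _ _ L0 D0 _ _ _ _ _ _ r r0 rT).
- exact: continuous_step.
- exact: continuous_step.
- exact/continuous_fopp/continuous_avg.
- exact/continuous_fopp/continuous_avg.
- by move=> s s0 _; exact: is_derive_step.
- by move=> s s0 _; exact: is_derive_step.
- by move=> s s0 _; exact: flux_step.
- by move=> s s0 _; exact: flux_step.
- by rewrite !step0.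
- move=> s s0 sT; apply: (le_trans (HL _ _ _ s0 sT)).
  by rewrite ler_wpM2l// uv.
Qed.

Let continuous_iter n : continuous (iter_ n).
Proof.
elim: n => [|n IH]; first exact: continuous_fcst.
exact: continuous_step.
Qed.

Let iter_norm n r : iter_ n `|r| = iter_ n r.
Proof. by case: n => [//|n]; rewrite /iter_ /= step_norm. Qed.

Let sol (r : R) := limn (fun n => iter_ n `|r|).

(** The constants depend on [T], but [sol] is a pointwise limit defined independently of [T], so no
    gluing of local solutions is required. Here [D] is the maximum on [[0, T]] of the first
    increment, and each further increment is halved in the weighted norm. *)
Let iter_cvg T : 0 <= T -> exists L D : R,
  [/\ 0 <= L, 0 <= D,
     forall r u v : R, 0 <= r -> r <= T -> `|hh r u - hh r v| <= L * `|u - v| &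
     forall r n, 0 <= r -> r <= T ->
       `|sol r - iter_ n r| <= 2 * (D * expR ((L + 1) * r)) * 2^-1 ^+ n].
Proof.
move=> T0; have [L L0 HL] := lip T.
have [c cT Hc] : exists2 c, c \in `[0, T]%R & forall t, t \in `[0, T]%R ->
    `|iter_ 1 t - iter_ 0 t| <= `|iter_ 1 c - iter_ 0 c|.
  apply: EVT_max => //; apply: continuous_subspaceT.
  have c1 := @continuous_iter 1%N; have c0 := @continuous_iter 0%N.
  exact: (continuous_fnorm (continuous_fadd c1 (continuous_fopp c0))).
pose D := `|iter_ 1 c - iter_ 0 c|; have D0 : 0 <= D by exact: normr_ge0.
exists L, D; split => // r n r0 rT.
have H k s : 0 <= s -> s <= T ->
    `|iter_ k.+1 s - iter_ k s| <= D * 2^-1 ^+ k * expR ((L + 1) * s).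
  elim: k s => [|k IH] s s0 sT.
    rewrite expr0 mulr1 (le_trans (Hc s _))//; first by rewrite in_itv/= s0.
    by rewrite ler_peMr// -expR0 ler_expR mulr_ge0// addr_ge0.
  rewrite exprSr mulrA; apply: (@step_contraction (iter_ k.+1) (iter_ k) T) => //.
  by rewrite mulr_ge0// exprn_ge0// invr_ge0.
have Hg k : `|iter_ k.+1 `|r| - iter_ k `|r| | <= D * expR ((L + 1) * r) * 2^-1 ^+ k.
  by rewrite (ger0_norm r0) mulrAC; exact: H.
have [_ /(_ n)] := geometric_cvg Hg.
by rewrite -/(sol r) iter_norm.
Qed.

Let sol_norm r : sol `|r| = sol r.
Proof. by rewrite /sol normr_id. Qed.

Let continuous_sol : continuous sol.
Proof.
move=> x; apply/cvgrPdist_le => e e0.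
have T0 : 0 <= `|x| + 1 by rewrite addr_ge0.
have [L [D [L0 D0 _ H]]] := iter_cvg T0.
have [n Hn] := half_pow_small (2 * (D * expR ((L + 1) * (`|x| + 1)))) (divr_gt0 e0 (ltr0n R 3)).
have H' y : `|y| <= `|x| + 1 -> `|sol y - iter_ n y| <= e / 3.
  move=> yx; rewrite -sol_norm -iter_norm (le_trans (H _ n _ _))//.
  rewrite (le_trans _ Hn)// ler_wpM2r ?exprn_ge0 ?invr_ge0//.
  by rewrite !ler_wpM2l// ler_expR ler_wpM2l// addr_ge0.
have e3 : 0 < e / 3 by rewrite divr_gt0.
have /cvgrPdist_le/(_ _ e3)[d /= d0 hd] := @continuous_iter n x.
exists (Num.min d 1); rewrite /= ?lt_min ?d0 ?ltr01// => y /=.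
rewrite lt_min => /andP[xyd xy1].
have h1 : `|sol x - iter_ n x| <= e / 3 by apply: H'; rewrite lerDl.
have h2 : `|sol y - iter_ n y| <= e / 3.
  apply: H'; rewrite -lerBlDl (le_trans (lerB_dist _ _))// distrC.
  exact: ltW.
have h3 := hd y xyd.
move: h1 h2 h3; rewrite !ler_norml => /andP[? ?] /andP[? ?] /andP[? ?].
apply/andP; split; lra.
Qed.

Let sol_fixpoint r : step sol r = sol r.
Proof.
rewrite -step_norm -sol_norm.
set t := `|r|; have t0 : 0 <= t by exact: normr_ge0.
have [L [D [L0 D0 HL H]]] := iter_cvg t0.
apply/eqP; rewrite -subr_eq0 -normr_le0; apply/ler_addgt0Pr => e e0.
rewrite add0r.
have [n Hn] := half_pow_small (2 * (D * expR ((L + 1) * t))) e0.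
(* [step sol] is compared with [sol] through [iter_ n.+1 = step (iter_ n)]: both distances are at
   most [D 2^-n] times the exponential weight. *)
have := @step_contraction sol (iter_ n) t L (2 * D * 2^-1 ^+ n) continuous_sol
  (@continuous_iter n) L0.
move=> /(_ _ HL)/=; have p0 : 0 <= (2^-1 : R) ^+ n by rewrite exprn_ge0// invr_ge0.
move=> /(_ _ _ t t0 (lexx t)) h1.
have {}h1 : `|step sol t - iter_ n.+1 t| <= 2 * D * 2^-1 ^+ n / 2 * expR ((L + 1) * t).
  apply: h1; first by rewrite !mulr_ge0.
  move=> s s0 st; rewrite (le_trans (H s n s0 st))// le_eqVlt; apply/orP; left.
  by apply/eqP; ring.
have h2 := H t n.+1 t0 (lexx t).
rewrite (_ : _ - _ = (step sol t - iter_ n.+1 t) - (sol t - iter_ n.+1 t)); last by ring.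
apply: (le_trans (ler_normB _ _)); apply: (le_trans (lerD h1 h2)).
rewrite exprS; lra.
Qed.

Lemma picard_radial : exists u p : R -> R,
  [/\ continuous u, continuous p, u 0 = a, p 0 = 0 &
     (forall r, 0 < r -> is_derive r 1 u (p r)) /\
     (forall r, 0 < r ->
       is_derive r 1 (fun s => s ^+ m * p s) (- (r ^+ m * hh r (u r))))].
Proof.
have cs := continuous_sol.
exists sol, (fun r => - avg sol r); split => //.
- exact/continuous_fopp/continuous_avg.
- by rewrite -sol_fixpoint step0.
- by rewrite /avg radial_avg0// oppr0.
split => r r0; last exact: flux_step.
apply: near_eq_is_derive (is_derive_step cs r0).
by apply: filterE => s; exact: sol_fixpoint.
Qed.

End picard.

(** * Regularity of [f] and of its primitive *)

Section nonlinearity_facts.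
Context {R : realType}.
Variable f : R -> R -> R.
Hypothesis g1 : assumption_g1 f.
Implicit Types (r s t u v x c e K L T : R).

(** Composition with the retraction [r |-> |r|] onto the half-line turns continuity relative to the
    half-plane into plain continuity on the plane. *)
Lemma continuous_norm_fst : continuous (fun p : R * R => f `|p.1| p.2).
Proof.
case: g1 => /subspace_continuousP cf _ _ p.
pose phi (q : R * R) := (`|q.1|, q.2).
have phip : phi q @[q --> p] --> phi p.
  have h1 : `|q.1| @[q --> p] --> `|p.1| by apply: cvg_norm; exact: cvg_fst.
  have h2 : q.2 @[q --> p] --> p.2 by exact: cvg_snd.
  exact: (cvg_pair h1 h2).
have H := cf (phi p) (normr_ge0 p.1).
move=> A /H /=; rewrite /within/= => HA.
have {}HA : \forall q \near p, 0 <= `|q.1| -> A (f `|q.1| q.2) := phip _ HA.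
by apply: filterS HA => q; apply.
Qed.

Lemma continuous_section r : 0 <= r -> continuous (f r).
Proof.
move=> r0 u; have cp : (r, v) @[v --> u] --> (r, u).
  exact: (cvg_pair (cvg_cst r) (cvg_id (F := nbhs u))).
have := cvg_comp _ _ cp (@continuous_norm_fst (r, u)).
rewrite /= (ger0_norm r0); set g := (_ \o _).
by rewrite (_ : g = f r)//; apply/funext => v; rewrite /g/= ger0_norm.
Qed.

Lemma locally_close c x e : 0 <= c -> 0 < e -> exists2 d : R, 0 < d &
  forall r u, 0 <= r -> `|r - c| < d -> `|u - x| < d -> `|f r u - f c x| < e.
Proof.
move=> c0 e0.
have /cvgrPdist_lt/(_ _ e0)/nbhs_ballP[d /= d0 H] := @continuous_norm_fst (c, x).
exists d => // r u r0 rc ux.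
have := H (r, u); rewrite /= (ger0_norm c0) (ger0_norm r0) distrC; apply.
by split; rewrite /ball/= distrC.
Qed.

(** Compactness of the set of triples [(r, u, v)]. Near a triple with [u = v] the local Lipschitz
    condition gives a constant; near one with [u <> v] the difference of values is bounded by
    continuity and [|u - v|] stays away from 0. *)
Lemma lipschitz_box T K : exists2 L : R, 0 <= L & forall r u v : R,
  0 <= r -> r <= T -> `|u| <= K -> `|v| <= K -> `|f r u - f r v| <= L * `|u - v|.
Proof.
have [_ _ lf] := g1.
pose box := `[0, T]%classic `*` (`[-K, K]%classic `*` `[-K, K]%classic).
pose P (L : R) (p : R * (R * R)) := 0 <= p.1 ->
  `|f p.1 p.2.1 - f p.1 p.2.2| <= L * `|p.2.1 - p.2.2|.
have cbox : compact box by do 2 (apply: compact_setX; first exact: segment_compact);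
  exact: segment_compact.
have /(_ R (@pinfty_nbhs R) P _) H := (compact_near_coveringP box).1 cbox.
have {}H : \forall L \near +oo, box `<=` P L.
  apply: H => -[r0 [u0 v0]] [/= r0T _].
  have {r0T} r00 : 0 <= r0 by move: r0T; rewrite in_itv/= => /andP[].
  suff [d [L [d0 Hd]]] : exists d L : R, 0 < d /\ forall r u v, 0 <= r ->
      `|r - r0| < d -> `|u - u0| < d -> `|v - v0| < d ->
      `|f r u - f r v| <= L * `|u - v|.
    exists (ball (r0, (u0, v0)) d, [set M : R | L <= M]).
      split => /=; first exact: nbhsx_ballx.
      by apply: nbhs_pinfty_ge; exact: num_real.
    move=> [[r [u v]] M] [/= [/= b1 [/= b2 b3]] LM] /= r_0.
    apply: le_trans (Hd r u v r_0 _ _ _) _; rewrite 1?distrC//.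
    by rewrite ler_wpM2r.
  have [<-|uv] := eqVneq u0 v0.
    have [d d0 [L HL]] := lf r0 u0 r00; exists d, L; split => //.
  (* A third of the distance: if [u] and [v] each move by less than [del], they remain at distance
     at least [del]. *)
  have [del Edel] : exists del, `|u0 - v0| = 3 * del.
    by exists (`|u0 - v0| / 3); field.
  have del0 : 0 < del by rewrite -(pmulr_rgt0 _ (ltr0n R 3)) -Edel normr_gt0 subr_eq0.
  have [d1 d10 H1] := locally_close u0 r00 ltr01.
  have [d2 d20 H2] := locally_close v0 r00 ltr01.
  pose B := `|f r0 u0 - f r0 v0| + 2.
  exists (Num.min del (Num.min d1 d2)), (B / del); split.
    by rewrite !lt_min del0 d10.
  move=> r u v r_0; rewrite !lt_min => /and3P[_ ra rb] /and3P[ua ub _].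
  move=> /and3P[va _ vb].
  have h1 := H1 r u r_0 ra ub; have h2 := H2 r v r_0 rb vb.
  have hB : `|f r u - f r v| <= B.
    rewrite (_ : _ - _ = (f r0 u0 - f r0 v0) +
      ((f r u - f r0 u0) - (f r v - f r0 v0))); last by ring.
    apply: (le_trans (ler_normD _ _)); rewrite lerD2l.
    by apply: (le_trans (ler_normB _ _)); lra.
  have hd : del <= `|u - v|.
    have : `|u0 - v0| <= `|u - v| + `|u - u0| + `|v - v0|.
      rewrite (_ : u0 - v0 = (u - v) - (u - u0) + (v - v0)); last by ring.
      apply: (le_trans (ler_normD _ _)); rewrite lerD2r.
      exact: ler_normB.
    by rewrite Edel; lra.
  apply: (le_trans hB); rewrite -mulrA ler_peMr//; first by rewrite addr_ge0.
  by rewrite mulrC ler_pdivlMr ?mul1r.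
have [L L0 HL] := pinfty_ex_ge (real0 R) H.
exists L => // r u v r0 rT uK vK; apply: (HL (r, (u, v))) => //=.
by split => /=; rewrite ?in_itv/= -?ler_norml ?r0//; split => /=; rewrite in_itv/= -ler_norml.
Qed.

Definition clamp K u := Num.max (- K) (Num.min u K).

Lemma clamp_norm K u : 0 <= K -> `|clamp K u| <= K.
Proof.
move=> K0; rewrite /clamp ler_norml le_max lexx/= ge_max ge_min lexx orbT andbT.
by rewrite ge0_cp.
Qed.

Lemma clamp_id K u : `|u| <= K -> clamp K u = u.
Proof.
by rewrite ler_norml => /andP[h1 h2]; rewrite /clamp (min_l h2) (max_r h1).
Qed.

Lemma clamp_lipschitz K u v : 0 <= K -> `|clamp K u - clamp K v| <= `|u - v|.
Proof.
move=> K0; suff H x y : x <= y -> 0 <= clamp K y - clamp K x /\ clamp K y - clamp K x <= y - x.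
  case: (leP u v) => uv.
    by have [h1 h2] := H _ _ uv; rewrite distrC (distrC u) !ger0_norm// subr_ge0.
  by have [h1 h2] := H _ _ (ltW uv); rewrite !ger0_norm// subr_ge0 ltW.
move=> xy; rewrite /clamp; case: (leP x K) => ?; case: (leP y K) => ?;
  by case: (leP (- K) x) => ?; case: (leP (- K) y) => ?;
  case: (leP (- K) K) => ?; split; lra.
Qed.

Lemma continuous_clamp K : 0 <= K -> continuous (clamp K).
Proof.
move=> K0 x; apply/cvgrPdist_lt => e e0; exists e => //= y xy.
exact: le_lt_trans (clamp_lipschitz _ _ K0) xy.
Qed.

Lemma continuous_norm_fst_clamp K : 0 <= K ->
  continuous (fun p : R * R => f `|p.1| (clamp K p.2)).
Proof.
move=> K0 p; have cp : (q.1, clamp K q.2) @[q --> p] --> (p.1, clamp K p.2).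
  have h1 : q.1 @[q --> p] --> p.1 by exact: cvg_fst.
  have h2 : q.2 @[q --> p] --> p.2 by exact: cvg_snd.
  exact: (cvg_pair h1 (cvg_comp _ _ h2 (@continuous_clamp K K0 _))).
exact: (cvg_comp _ _ cp (@continuous_norm_fst (p.1, clamp K p.2))).
Qed.

Lemma is_derive_primitive r u : 0 <= r -> is_derive u 1 (primitive f r) (f r u).
Proof. by move=> r0; exact/is_derive_oriented_int/continuous_section. Qed.

Lemma continuous_primitive r : 0 <= r -> continuous (primitive f r).
Proof. by move=> r0 u; exact: is_derive_continuous (is_derive_primitive u r0). Qed.

(** Positivity of [r] is essential to the use of (g_3), and is the reason why energies are never
    started at the origin. *)
Lemma primitive_antitone u r s : assumption_g3 f -> 0 < r -> r <= s ->
  primitive f s u <= primitive f r u.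
Proof.
move=> /(_ u)[d _ d0] r0 rs.
have H x : x \in `[r, s] -> 0 < x.
  by rewrite in_itv/= => /andP[rx _]; exact: lt_le_trans rx.
apply: (@ler0_derive1_le_cc R (fun s => primitive f s u) r s) => //.
- by move=> x xrs; apply/d/H; exact: subset_itv_oo_cc.
- by move=> x xrs; apply/d0/H; exact: subset_itv_oo_cc.
- by apply: derivable_within_continuous => x /H; exact: d.
- by rewrite in_itv/= rs lexx.
- by rewrite in_itv/= lexx rs.
Qed.

End nonlinearity_facts.

Section derivative_increments.
Context {R : realType}.
Implicit Types (g u : R -> R) (x l r s t e d : R).

Lemma is_deriveP g x l : is_derive x 1 g l <->
  forall e, 0 < e -> exists2 d, 0 < d &
    forall s, `|s - x| < d -> `|g s - g x - l * (s - x)| <= e * `|s - x|.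
Proof.
pose F (h : R) := h^-1 *: ((g \o shift x) (h *: 1) - g x).
have FE h : h != 0 -> `|l - F h| = `|g (h + x) - g x - l * h| / `|h|.
  move=> h0; rewrite /F/= /GRing.scale/= mulr1 distrC -normfV -normrM.
  by congr `|_|; field.
split=> [dg e e0|H].
  have : F h @[h --> 0^'] --> l.
    have cvF : cvg (F h @[h --> 0^']) := @ex_derive _ _ _ _ _ _ _ dg.
    have <- : lim (F h @[h --> 0^']) = l := @derive_val _ _ _ _ _ _ _ dg.
    exact: cvF.
  move=> /cvgrPdist_le/(_ e e0)[d /= d0 Hd]; exists d => // s sx.
  have [->|sx0] := eqVneq s x; first by rewrite !subrr mulr0 subrr normr0 mulr0.
  have h0 : s - x != 0 by rewrite subr_eq0.
  have := Hd (s - x); rewrite /ball_/= sub0r normrN FE// subrK => /(_ sx h0).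
  by rewrite ler_pdivrMr ?normr_gt0.
have cF : F h @[h --> 0^'] --> l.
  apply/cvgrPdist_le => e e0; have [d d0 Hd] := H e e0.
  exists d => //= h; rewrite /ball_/= sub0r normrN => hd h0.
  rewrite FE// ler_pdivrMr ?normr_gt0//.
  by have := Hd (h + x); rewrite addrK; apply.
apply: DeriveDef; first by apply/cvg_ex; exists l.
exact: cvg_lim.
Qed.

Lemma is_derive_le0_right g x l e : is_derive x 1 g l -> l <= 0 -> 0 < e ->
  \forall s \near x^'+, g s <= g x + e * (s - x).
Proof.
move=> /is_deriveP H l0 e0; have [d d0 Hd] := H e e0.
exists d => //= s; rewrite /ball_/= distrC => sd xs.
have sx0 : 0 <= s - x by rewrite subr_ge0 ltW.
have := Hd s sd; rewrite (ger0_norm sx0).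
rewrite ler_norml => /andP[_].
have : l * (s - x) <= 0 by rewrite mulr_le0_ge0// subr_ge0 ltW.
lra.
Qed.

End derivative_increments.

(** * Monotonicity of energies containing [F] *)

Section energy.
Context {R : realType}.
Variable f : R -> R -> R.
Hypotheses (g1 : assumption_g1 f) (g2 : assumption_g2 f) (g3 : assumption_g3 f).
Local Notation F := (primitive f).
Implicit Types (r s t a b e d : R).

(* [F] is only separately differentiable, and [F (., u)] only nonincreasing,
   so that the chain rule is replaced by one-sided increments:
   [F (s, u s) - F (c, u c) <= F (c, u s) - F (c, u c)] for [s >= c]. *)
Lemma energy_nonincreasing (u p S w dS dw : R -> R) a b : 0 < a -> a <= b ->
  (forall r, a <= r -> r <= b -> is_derive r 1 u (p r)) ->
  (forall r, a <= r -> r <= b -> is_derive r 1 S (dS r)) ->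
  (forall r, a <= r -> r <= b -> is_derive r 1 w (dw r)) ->
  (forall r, a <= r -> 0 <= w r) ->
  (forall r, a <= r -> r <= b ->
    dS r + dw r * F r (u r) + w r * (f r (u r) * p r) <= 0) ->
  S b + w b * F b (u b) <= S a + w a * F a (u a).
Proof.
move=> a0 ab du dS_ dw_ w0 neg.
apply: (@dini_le _ (fun s => S s + w s * F s (u s))) => // c e ac cb e0.
  have cb' := ltW cb; have c0 : 0 < c by exact: lt_le_trans ac.
  have dF := is_derive_primitive g1 (u c) (ltW c0).
  have d : is_derive c 1 (fun s => S s + w s * F c (u s))
      (dS c + dw c * F c (u c) + w c * (f c (u c) * p c)).
    have := dS_ c ac cb'; have := dw_ c ac cb'.
    have := is_derive_fcomp dF (du c ac cb') => ? ? ?.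
    by derive_eq; ring.
  have := is_derive_le0_right d (neg c ac cb') e0.
  apply: filterS2 (nbhs_right_gt c) => s cs; apply: le_trans.
  by rewrite lerD2l ler_wpM2l ?w0 ?(le_trans ac (ltW cs))// primitive_antitone// ltW.
have ac' := ltW ac; have c0 : 0 < c by exact: lt_le_trans ac'.
have cu : {for c, continuous u} by exact: is_derive_continuous (du c ac' cb).
have cS : {for c, continuous S} by exact: is_derive_continuous (dS_ c ac' cb).
have cw : {for c, continuous w} by exact: is_derive_continuous (dw_ c ac' cb).
have [d d0 Hd] := locally_close g1 (u c) (ltW c0) ltr01.
(* Bounds uniform in [s] near [c]: [B] for [f (s, x)] with [x] near [u c], and [A] for [F (s, u c)]
   by monotonicity in [s]. After [F (c, u c) <= F (s, u c)], the increments of [S], of [w], and of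
   [F (s, .)] each receive [e / 3]. *)
pose B := `|f c (u c)| + 1; have B0 : 0 < B by rewrite ltr_wpDl.
pose A := F a (u c); have A0 : 0 <= A by have [] := g2 (u c) (ltW a0).
have w1 : 0 < w c + 1 by rewrite ltr_wpDl// w0.
have e1 : 0 < e / 3 by rewrite divr_gt0.
have e2 : 0 < e / 3 / (A + 1) by rewrite divr_gt0// ltr_wpDl.
have e3 : 0 < e / 3 / (w c + 1) / B by rewrite !divr_gt0.
have lS : S x @[x --> c^'-] --> S c by exact: cvg_at_left_filter.
have lw : w x @[x --> c^'-] --> w c by exact: cvg_at_left_filter.
have lu : u x @[x --> c^'-] --> u c by exact: cvg_at_left_filter.
near=> s.
have as_ : a <= s by apply: ltW; near: s; exact: nbhs_left_gt.
have sc : s < c by near: s; exact: nbhs_left_lt.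
have s0 : 0 < s by exact: lt_le_trans as_.
have hd : `|s - c| < d.
  rewrite ltr0_norm ?subr_lt0// opprB ltrBlDr -ltrBlDl.
  by near: s; apply: nbhs_left_gt; rewrite ltrBlDr ltrDl.
have hS : `|S c - S s| <= e / 3 by near: s; move/cvgrPdist_le: lS; exact.
have hw : `|w c - w s| <= e / 3 / (A + 1) by near: s; move/cvgrPdist_le: lw; exact.
have hw1 : `|w c - w s| <= 1 by near: s; move/cvgrPdist_le: lw; exact.
have hu : `|u c - u s| <= e / 3 / (w c + 1) / B by near: s; move/cvgrPdist_le: lu; exact.
have hud : `|u c - u s| < d by near: s; move/cvgrPdist_lt: lu; exact.
have FsA : F s (u c) <= A by rewrite primitive_antitone.
have Fs0 : 0 <= F s (u c) by have [] := g2 (u c) (ltW s0).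
have Fc : F c (u c) <= F s (u c) by rewrite primitive_antitone// ltW.
have hF : `|F s (u c) - F s (u s)| <= B * `|u c - u s|.
  have fB x : `|x - u c| < d -> `|f s x| <= B.
    move=> xd; have := Hd s x (ltW s0) hd xd; rewrite /B => h.
    by have := lerB_dist (f s x) (f c (u c)); lra.
  have mvt x y : x <= y -> `|x - u c| < d -> `|y - u c| < d ->
      `|F s y - F s x| <= B * `|y - x|.
    move=> xy xd yd.
    have [z _||z zxy ->] := @MVT_segment _ (F s) (f s) x y xy.
    - exact/is_derive_primitive/ltW.
    - exact/continuous_subspaceT/continuous_primitive/ltW.
    rewrite normrM ler_wpM2r// fB//; move: zxy xd yd; rewrite in_itv/= => /andP[].
    by rewrite !ltr_norml => ? ? /andP[? ?] /andP[? ?]; apply/andP; split; lra.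
  have uc : `|u c - u c| < d by rewrite subrr normr0.
  have us : `|u s - u c| < d by rewrite distrC.
  have [cs|/ltW sc'] := leP (u c) (u s); last exact: mvt.
  by rewrite distrC (distrC (u c)); exact: mvt.
have h1 : w c * F c (u c) <= w c * F s (u c) by rewrite ler_wpM2l// w0.
have h2 : (w c - w s) * F s (u c) <= e / 3.
  apply: (@le_trans _ _ (e / 3 / (A + 1) * (A + 1))); last by rewrite divfK// gt_eqF// ltr_wpDl.
  apply: (@le_trans _ _ (`|w c - w s| * F s (u c))); first by rewrite ler_wpM2r// ler_norm.
  by rewrite ler_pM//; lra.
have h3 : w s * (F s (u c) - F s (u s)) <= e / 3.
  apply: (@le_trans _ _ ((w c + 1) * (B * (e / 3 / (w c + 1) / B)))); last first.
    by rewrite le_eqVlt; apply/orP; left; apply/eqP; field; rewrite !gt_eqF.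
  apply: (@le_trans _ _ (w s * `|F s (u c) - F s (u s)|)).
    by rewrite ler_wpM2l ?w0// ler_norm.
  apply: ler_pM; rewrite ?w0//; first by move: hw1; rewrite ler_norml => /andP[]; lra.
  by apply: (le_trans hF); rewrite ler_wpM2l// ltW.
have h4 : S c - S s <= e / 3 by exact: le_trans (ler_norm _) hS.
lra.
Unshelve. all: by end_near. Qed.


End energy.

(** * Global existence for the radial equation *)

Section radial_ode.
Context {R : realType} (m : nat) (k : R) (f : R -> R -> R).
Hypotheses (m0 : (0 < m)%N) (k0 : 0 < k).
Hypotheses (g1 : assumption_g1 f) (g2 : assumption_g2 f) (g3 : assumption_g3 f).
Local Notation F := (primitive f).
Implicit Types (u v p q h : R -> R) (r s t a b e d : R).

(* [u'' + (m / r) u' + k^2 u + f (r, u) = 0] with [p = u'], in divergence form. *)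
Definition radial_ode u p := [/\ continuous u, continuous p,
  forall r, 0 < r -> is_derive r 1 u (p r) &
  forall r, 0 < r ->
    is_derive r 1 (fun s => s ^+ m * p s) (- (r ^+ m * (k ^+ 2 * u r + f r (u r))))].

Lemma is_derive_flux p (h r : R) : 0 < r ->
  is_derive r 1 (fun s => s ^+ m * p s) (- (r ^+ m * h)) ->
  is_derive r 1 p (- h - m%:R / r * p r).
Proof.
move=> r0 d; have rm0 : r ^+ m != 0 by rewrite expf_neq0// gt_eqF.
have dV := @is_derive_fV _ (fun s => s ^+ m) r _ rm0 (is_derive_exprn m r).
apply: (@near_eq_is_derive _ _ _ (fun s => (s ^+ m)^-1 * (s ^+ m * p s))).
  near=> s; have s0 : 0 < s by near: s; exact: lt_nbhsr.
  by rewrite mulrA mulVf ?mul1r// expf_neq0// gt_eqF.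
derive_eq; move: rm0; case: m m0 => // n _ /=; rewrite exprS mulf_eq0 negb_or => /andP[r1 rn].
by field; rewrite rn r1.
Unshelve. all: by end_near. Qed.

Lemma is_derive_radial_ode u p r : radial_ode u p -> 0 < r ->
  is_derive r 1 p (- (k ^+ 2 * u r + f r (u r)) - m%:R / r * p r).
Proof. by move=> [_ _ _ dp] r0; apply: is_derive_flux => //; exact: dp. Qed.

(** The energy has derivative at most [- (m / r) p^2]: the first-order term acts as damping. The
    equation is assumed on [[a, b]] only, so that the lemma applies to the truncated problem as long
    as the truncation is inactive. *)
Lemma radial_energy_le u p a b : 0 < a -> a <= b ->
  (forall r, a <= r -> r <= b -> is_derive r 1 u (p r)) ->
  (forall r, a <= r -> r <= b ->
    is_derive r 1 p (- (k ^+ 2 * u r + f r (u r)) - m%:R / r * p r)) ->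
  p b ^+ 2 / 2 + k ^+ 2 * u b ^+ 2 / 2 + F b (u b) <=
  p a ^+ 2 / 2 + k ^+ 2 * u a ^+ 2 / 2 + F a (u a).
Proof.
move=> a0 ab du dp.
have := @energy_nonincreasing _ f g1 g2 g3 u p
  (fun s => p s ^+ 2 / 2 + k ^+ 2 * u s ^+ 2 / 2) (fun=> 1)
  (fun s => p s * (- (k ^+ 2 * u s + f s (u s)) - m%:R / s * p s) + k ^+ 2 * u s * p s)
  (fun=> 0) a b a0 ab du _ _ _ _.
rewrite !mul1r; apply.
- move=> r ar rb; have := du r ar rb; have := dp r ar rb => ? ?.
  by derive_eq; rewrite /= ?expr1; field; rewrite gt_eqF// (lt_le_trans a0).
- by move=> r _ /=; rewrite ler01.
- move=> r ar rb; have r0 : 0 < r by exact: lt_le_trans ar.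
  rewrite (_ : _ + _ = - (m%:R / r * p r ^+ 2)); last by field; rewrite gt_eqF.
  by rewrite oppr_le0 mulr_ge0 ?sqr_ge0// divr_ge0// ltW.
Qed.

Lemma radial_ode_exists (a : R) :
  exists u p, [/\ radial_ode u p, u 0 = a & p 0 = 0].
Proof.
have fa0 : 0 <= f 0 a * a by have [h1 h2] := g2 a (lexx 0); lra.
(* The energy at the origin with [p = 0] and [F] replaced by its upper bound [f u / 2] from (g_2);
   the extra 1 is slack for starting at a small positive radius. *)
pose E := k ^+ 2 * a ^+ 2 / 2 + f 0 a * a / 2 + 1.
have E0 : 0 < E by rewrite ltr_wpDl// addr_ge0 ?divr_ge0// mulr_ge0 ?sqr_ge0.
have k2 : 0 < k ^+ 2 by rewrite exprn_gt0.
(* [M] bounds the square root of [z = 2 E / k^2], since [z <= (z + 1)^2] for [z >= 0]. *)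
pose M := 2 * E / k ^+ 2 + 1.
have M1 : 1 <= M by rewrite lerDr divr_ge0// ?sqr_ge0// mulr_ge0// ltW.
have leM x : k ^+ 2 * x ^+ 2 / 2 <= E -> `|x| <= M.
  move=> H; rewrite -(@ler_pXn2r _ 2)// ?nnegrE//; last by rewrite (le_trans _ M1).
  rewrite real_normK ?num_real//; apply: (@le_trans _ _ (2 * E / k ^+ 2)).
    by rewrite ler_pdivlMr//; lra.
  have z0 : 0 <= 2 * E / k ^+ 2 by rewrite divr_ge0// ?ltW// mulr_gt0.
  by rewrite /M; move: z0; set z := _ / _ => z0; nra.
pose K := M + 1; have K0 : 0 <= K by rewrite /K; lra.
pose hh r x := k ^+ 2 * x + f `|r| (clamp K x).
have chh : continuous (fun z : R * R => hh z.1 z.2).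
  move=> z; apply: (@continuousD R R (R * R)%type (fun z => k ^+ 2 * z.2)
    (fun z => f `|z.1| (clamp K z.2))); last exact: continuous_norm_fst_clamp.
  by apply: cvgM; [exact: cvg_cst|exact: cvg_snd].
have lip T : exists2 L : R, 0 <= L & forall r x y : R, 0 <= r -> r <= T ->
    `|hh r x - hh r y| <= L * `|x - y|.
  have [L L0 HL] := lipschitz_box g1 T K.
  exists (k ^+ 2 + L); first by rewrite addr_ge0// ltW.
  move=> r x y r0 rT.
  rewrite (_ : hh r x - hh r y = k ^+ 2 * (x - y) +
    (f `|r| (clamp K x) - f `|r| (clamp K y))); last by rewrite /hh; ring.
  apply: (le_trans (ler_normD _ _)); rewrite mulrDl normrM (ger0_norm (ltW k2)) lerD2l.
  rewrite (ger0_norm r0); apply: le_trans (HL r _ _ r0 rT _ _) _; try exact: clamp_norm.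
  by rewrite ler_wpM2l// clamp_lipschitz.
have [u [p [cu cp u0 p0 [du dp]]]] := picard_radial m0 a chh lip.
have small r : 0 <= r -> `|u r| <= K.
  move=> r0; apply: (@interval_ind _ (fun s => `|u s| <= K) 0 r) => //.
  - rewrite u0 (@le_trans _ _ M) ?leM//; last by rewrite lerDl.
    by rewrite /E; lra.
  - move=> c c0 cr H; apply/ler_addgt0Pr => e e0.
    have lu : u x @[x --> c^'-] --> u c by apply: cvg_at_left_filter; exact: cu.
    near c^'- => s.
    have sc : s < c by near: s; exact: nbhs_left_lt.
    have s0 : 0 < s by near: s; exact: nbhs_left_gt.
    have : `|u c - u s| <= e by near: s; move/cvgrPdist_le: lu; exact.
    by have := H s (ltW s0) sc; have := lerB_dist (u c) (u s); lra.
  (* Up to [c] the truncation is inactive, so the energy gives the bound [M] instead of [K = M + 1];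
     the gap keeps [|u|] below [K] a little to the right of [c]. *)
  - move=> c c0 cr H.
    have uM : `|u c| <= M.
      move: c0; rewrite le_eqVlt => /orP[/eqP <-|c0].
        by rewrite u0 leM// /E; lra.
      apply: leM.
      (* [G] dominates the energy at positive radii by (g_2) and is continuous at 0, so
         [G t <= G 0 + 1 = E] for small [t]. *)
      pose G s := p s ^+ 2 / 2 + k ^+ 2 * u s ^+ 2 / 2 + f `|s| (u s) * u s / 2.
      have cG : continuous G.
        have cf : continuous (fun s => f `|s| (u s)).
          apply: (@continuous_superposition _ (fun s x => f `|s| x)) => //.
          exact: continuous_norm_fst.
        by rewrite /G; continuous_formula.
      have lG : G x @[x --> 0^'+] --> G 0 by apply: cvg_at_right_filter; exact: cG.
      near (0 : R)^'+ => t.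
      have t0 : 0 < t by near: t; exact: nbhs_right_gt.
      have tc : t < c by near: t; exact: nbhs_right_lt.
      have : `|G 0 - G t| <= 1 by near: t; move/cvgrPdist_le: lG; exact.
      rewrite ler_norml => /andP[Gt _].
      have GE : G 0 + 1 = E by rewrite /G /E p0 u0 normr0 expr0n/= mul0r add0r.
      have := @radial_energy_le u p t c t0 (ltW tc) (fun r tr _ => du r (lt_le_trans t0 tr)).
      have dp' r' : t <= r' -> r' <= c ->
          is_derive r' 1 p (- (k ^+ 2 * u r' + f r' (u r')) - m%:R / r' * p r').
        move=> tr rc; have r'0 : 0 < r' by exact: lt_le_trans tr.
        apply: is_derive_flux => //; have := dp r' r'0.
        by rewrite /hh (gtr0_norm r'0) clamp_id// H// ltW.
      move=> /(_ dp').
      have [Fc _] := g2 (u c) (ltW c0).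
      have [_ Ft] := g2 (u t) (ltW t0).
      have p2 : 0 <= p c ^+ 2 / 2 by rewrite divr_ge0// sqr_ge0.
      move: Gt; rewrite {2}/G (gtr0_norm t0) => Gt.
      lra.
    have lu : u x @[x --> c^'+] --> u c by apply: cvg_at_right_filter; exact: cu.
    near=> s.
    have : `|u c - u s| <= 1 by near: s; move/cvgrPdist_le: lu; exact.
    by rewrite /K; have := lerB_dist (u s) (u c); rewrite distrC; lra.
exists u, p; split => //; split => // r r0.
rewrite -[X in f X](gtr0_norm r0) -[X in f _ X](clamp_id (small r (ltW r0))).
exact: dp.
Unshelve. all: by end_near. Qed.

End radial_ode.

(** * Decay at infinity and uniqueness *)

Section radial_ode_decay.
Context {R : realType} (m : nat) (k : R) (f : R -> R -> R).
Hypotheses (m0 : (0 < m)%N) (k0 : 0 < k).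
Hypotheses (g1 : assumption_g1 f) (g2 : assumption_g2 f) (g3 : assumption_g3 f).
Local Notation F := (primitive f).
Implicit Types (u v p q h : R -> R) (r s t a b e d : R).

(* With [g = m / 2] and [q = u' + g u / r], the derivative of
   [r^m (q^2 / 2 + k^2 u^2 / 2 + F)] is at most [c / r^2] times that quantity,
   where [c = |g^2 - g| / k]; the factor [expR (c / r)] absorbs this growth. *)
Lemma radial_ode_decay u p : radial_ode m k f u p ->
  exists C : R, forall r, 1 <= r -> r ^+ m * (p r ^+ 2 + u r ^+ 2) <= C.
Proof.
move=> ode; have [cu cp du _] := ode; have dp r := is_derive_radial_ode m0 ode (r := r).
pose g : R := m%:R / 2.
have mg : m%:R = 2 * g by rewrite /g; field.
have g0 : 0 <= g by rewrite /g divr_ge0.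
pose c := `|g ^+ 2 - g| / k; have c0 : 0 <= c by rewrite divr_ge0// ltW.
pose w s := expR (c * s^-1) * s ^+ m.
pose q s := p s + g * (u s * s^-1).
pose Q s := q s ^+ 2 / 2 + k ^+ 2 * u s ^+ 2 / 2.
pose dw s := w s * (m%:R / s - c / s ^+ 2).
pose dq s := - (k ^+ 2 * u s + f s (u s)) - m%:R / s * p s + g * (p s / s - u s / s ^+ 2).
have Q0 s : 0 <= Q s.
  by apply: addr_ge0; apply: divr_ge0 => //; rewrite ?sqr_ge0// -exprMn sqr_ge0.
have w0 s : 1 <= s -> 0 <= w s.
  by move=> s1; rewrite mulr_ge0 ?expR_ge0// exprn_ge0// (le_trans ler01).
have dwP s : 1 <= s -> is_derive s 1 w (dw s).
  move=> s1; have s0 : s != 0 by rewrite gt_eqF// (lt_le_trans ltr01).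
  have ? := @is_derive_fV _ (fun s => s) s _ s0 (is_derive_fid s).
  derive_eq; rewrite /dw /w; case: m m0 => // n _ /=; rewrite (exprS s n).
  by field.
have dqP s : 1 <= s -> is_derive s 1 q (dq s).
  move=> s1; have s0' : 0 < s by exact: lt_le_trans s1.
  have s0 : s != 0 by rewrite gt_eqF.
  have ? := @is_derive_fV _ (fun s => s) s _ s0 (is_derive_fid s).
  have := dp s s0'; have := du s s0' => ? ?.
  by derive_eq; rewrite /dq; field.
have H r : 1 <= r -> w r * Q r <= w 1 * Q 1 + w 1 * F 1 (u 1).
  move=> r1; have r0 : 0 < r by exact: lt_le_trans r1.
  apply: (@le_trans _ _ (w r * Q r + w r * F r (u r))).
    by rewrite lerDl mulr_ge0 ?w0//; have [] := g2 (u r) (ltW r0).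
  apply: (@energy_nonincreasing _ f g1 g2 g3 u p (fun s => w s * Q s) w
    (fun s => dw s * Q s + w s * (q s * dq s + k ^+ 2 * u s * p s)) dw 1 r) => //.
  - by move=> s s1 _; apply: du; exact: lt_le_trans s1.
  - move=> s s1 _; have := dwP s s1; have := dqP s s1.
    have := du s (lt_le_trans ltr01 s1) => ? ? ?.
    by rewrite /Q; derive_eq; rewrite /= ?expr1; field.
  - by move=> s s1 _; exact: dwP.
  move=> s s1 _; have s0 : 0 < s by exact: lt_le_trans s1.
  have sn0 : s != 0 by rewrite gt_eqF.
  have [F0 F1] := g2 (u s) (ltW s0).
  (* All terms of order [1 / s] cancel except [2 F - f u], which is nonpositive by (g_2). At order
     [1 / s^2], the cross term [u q] is absorbed by [c Q], because [k |u| |q| <= Q]. *)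
  rewrite [leLHS](_ : _ = w s * ((g / s) * (2 * F s (u s) - f s (u s) * u s)
    + s ^- 2 * ((g ^+ 2 - g) * (u s * q s) - c * Q s - c * F s (u s)))); last first.
    rewrite /dw /Q /dq mg.
    have -> : p s = q s - g * (u s / s) by rewrite /q; ring.
    by field.
  apply: mulr_ge0_le0; first exact: w0.
  have h1 : g / s * (2 * F s (u s) - f s (u s) * u s) <= 0.
    by apply: mulr_ge0_le0; [rewrite divr_ge0// ltW|lra].
  have h2 : s ^- 2 * ((g ^+ 2 - g) * (u s * q s) - c * Q s - c * F s (u s)) <= 0.
    apply: mulr_ge0_le0; first by rewrite invr_ge0 sqr_ge0.
    have cF : 0 <= c * F s (u s) by rewrite mulr_ge0.
    suff : (g ^+ 2 - g) * (u s * q s) <= c * Q s by lra.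
    apply: le_trans (ler_norm _) _; rewrite normrM /c -mulrA ler_wpM2l//.
    rewrite ler_pdivlMl// mulrC normrM.
    have : 0 <= (`|q s| - k * `|u s|) ^+ 2 by exact: sqr_ge0.
    have E1 : `|q s| ^+ 2 = q s ^+ 2 by rewrite real_normK ?num_real.
    have E2 : `|u s| ^+ 2 = u s ^+ 2 by rewrite real_normK ?num_real.
    by rewrite /Q -E1 -E2; nra.
  lra.
set C0 := w 1 * Q 1 + w 1 * F 1 (u 1) in H.
have k2 : 0 < k ^+ 2 by rewrite exprn_gt0.
(* For [r >= 1], [p^2 <= 2 q^2 + 2 g^2 u^2], while [q^2 <= 2 Q] and [u^2 <= (2 / k^2) Q]. *)
exists ((4 + (2 * g ^+ 2 + 1) * (2 / k ^+ 2)) * C0) => r r1.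
have r0 : 0 < r by exact: lt_le_trans r1.
have rm0 : 0 <= r ^+ m by rewrite exprn_ge0// ltW.
have C : r ^+ m * Q r <= C0.
  apply: le_trans (H r r1); rewrite ler_wpM2r// /w ler_peMl//.
  by rewrite -expR0 ler_expR mulr_ge0// invr_ge0 ltW.
set D := 4 + _; have D0 : 0 <= D.
  apply: addr_ge0 => //; apply: mulr_ge0; last by rewrite divr_ge0// sqr_ge0.
  by apply: addr_ge0 => //; apply: mulr_ge0 => //; exact: sqr_ge0.
apply: (@le_trans _ _ (D * (r ^+ m * Q r))); last by rewrite ler_wpM2l.
rewrite mulrCA ler_wpM2l//.
have E : p r = q r - g * (u r / r) by rewrite /q; ring.
have ur : (u r / r) ^+ 2 <= u r ^+ 2.
  by rewrite exprMn ler_piMr ?sqr_ge0// exprVn invf_le1 ?exprn_gt0// expr_ge1// ltW.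
have : p r ^+ 2 <= 2 * q r ^+ 2 + 2 * g ^+ 2 * u r ^+ 2.
  have : 0 <= (q r + g * (u r / r)) ^+ 2 by exact: sqr_ge0.
  have : (g * (u r / r)) ^+ 2 <= g ^+ 2 * u r ^+ 2.
    by rewrite exprMn ler_wpM2l// sqr_ge0.
  by rewrite E; set z := g * (u r / r); nra.
move=> hp; rewrite /D /Q.
have hq2 : 0 <= q r ^+ 2 by exact: sqr_ge0.
have hu2 : 0 <= u r ^+ 2 by exact: sqr_ge0.
rewrite (_ : (4 + (2 * g ^+ 2 + 1) * (2 / k ^+ 2)) * _ =
  2 * q r ^+ 2 + 2 * k ^+ 2 * u r ^+ 2 + (2 * g ^+ 2 + 1) * (q r ^+ 2 / k ^+ 2)
  + (2 * g ^+ 2 + 1) * u r ^+ 2); last by field; rewrite gt_eqF.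
have : 0 <= (2 * g ^+ 2 + 1) * (q r ^+ 2 / k ^+ 2).
  apply: mulr_ge0; last by apply: divr_ge0; exact: sqr_ge0.
  by apply: addr_ge0 => //; apply: mulr_ge0 => //; exact: sqr_ge0.
have : 0 <= k ^+ 2 * u r ^+ 2 by rewrite mulr_ge0// ltW.
lra.
Qed.

Lemma continuous_itv_bounded h T : continuous h -> exists2 B : R, 0 <= B &
  forall s, 0 <= s -> s <= T -> `|h s| <= B.
Proof.
move=> ch; have [T0|T0] := leP 0 T; last first.
  by exists 0 => // s s0 sT; have := le_trans s0 sT; rewrite leNgt T0.
have [|c _ H] := @EVT_max _ (fun s => `|h s|) 0 T T0.
  exact/continuous_subspaceT/continuous_fnorm.
by exists `|h c| => // s s0 sT; apply: H; rewrite in_itv/= s0.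
Qed.

(** Both solutions are bounded on [[0, T]], so [f] is Lipschitz on the relevant box. The contraction
    then improves any weighted bound on [u - v] by a factor 2, and it can be iterated
    indefinitely. *)
Lemma radial_ode_unique u v p q : radial_ode m k f u p -> radial_ode m k f v q ->
  u 0 = v 0 -> forall r, 0 <= r -> u r = v r.
Proof.
move=> [cu cp du dp] [cv cq dv dq] uv0 T T0.
have [B1 B10 HB1] := continuous_itv_bounded T cu.
have [B2 B20 HB2] := continuous_itv_bounded T cv.
pose K := B1 + B2; have [L L0 HL] := lipschitz_box g1 T K.
pose l := k ^+ 2 + L; have l0 : 0 <= l by rewrite addr_ge0// sqr_ge0.
have uK s : 0 <= s -> s <= T -> `|u s| <= K.
  by move=> s0 sT; rewrite (le_trans (HB1 s s0 sT))// lerDl.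
have vK s : 0 <= s -> s <= T -> `|v s| <= K.
  by move=> s0 sT; rewrite (le_trans (HB2 s s0 sT))// lerDr.
have step D : 0 <= D ->
  (forall s, 0 <= s -> s <= T -> `|u s - v s| <= D * expR ((l + 1) * s)) ->
  forall s, 0 <= s -> s <= T -> `|u s - v s| <= D / 2 * expR ((l + 1) * s).
  move=> D0 HD; refine (@radial_contraction2 _ m m0 u v p q
    (fun s => k ^+ 2 * u s + f s (u s)) (fun s => k ^+ 2 * v s + f s (v s)) T l D
    cu cv cp cq l0 D0 _ _ _ _ uv0 _).
  - by move=> r r0 _; exact: du.
  - by move=> r r0 _; exact: dv.
  - by move=> r r0 _; exact: dp.
  - by move=> r r0 _; exact: dq.
  - move=> s s0 sT; apply: le_trans (ler_wpM2l l0 (HD s s0 sT)).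
    rewrite (_ : _ - _ = k ^+ 2 * (u s - v s) + (f s (u s) - f s (v s))); last by ring.
    apply: (le_trans (ler_normD _ _)); rewrite /l mulrDl normrM (ger0_norm (sqr_ge0 k)).
    by rewrite lerD2l HL ?uK ?vK.
have iter n s : 0 <= s -> s <= T ->
    `|u s - v s| <= K * 2^-1 ^+ n * expR ((l + 1) * s).
  elim: n s => [|n IH] s s0 sT.
    rewrite expr0 mulr1; apply: (@le_trans _ _ (K * 1)).
      by rewrite mulr1 (le_trans (ler_normB _ _))// lerD ?HB1 ?HB2.
    rewrite ler_wpM2l ?addr_ge0// -expR0 ler_expR mulr_ge0// addr_ge0//.
  rewrite exprSr mulrA; apply: step => //.
  by rewrite mulr_ge0 ?addr_ge0// exprn_ge0// invr_ge0.
apply/eqP; rewrite -subr_eq0 -normr_le0; apply/ler_addgt0Pr => e e0; rewrite add0r.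
have [n Hn] := half_pow_small (K * expR ((l + 1) * T)) e0.
by apply: le_trans Hn; rewrite mulrAC; exact: iter.
Qed.

End radial_ode_decay.

(** * One-sided derivatives on the half-line *)

Section half_derivatives.
Context {R : realType}.
Implicit Types (u v p : R -> R) (r l s e d : R).

Definition is_half_derive u r l := forall e, 0 < e -> exists2 d, 0 < d &
  forall s, 0 <= s -> `|s - r| < d -> `|u s - u r - l * (s - r)| <= e * `|s - r|.

Lemma half_quotient_cvgP u r l : 0 <= r ->
  half_quotient u r s @[s --> within half_line r^'] --> l <-> is_half_derive u r l.
Proof.
move=> r0.
have E s : s != r -> `|l - half_quotient u r s| = `|u s - u r - l * (s - r)| / `|s - r|.
  move=> sr; have sr0 : s - r != 0 by rewrite subr_eq0.
  by rewrite /half_quotient distrC -normfV -normrM; congr `|_|; field.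
split=> [/cvgrPdist_le H e e0|H].
  have [d /= d0 Hd] := H e e0; exists d => // s s0 sr.
  have [->|srN] := eqVneq s r; first by rewrite !subrr mulr0 subrr normr0 mulr0.
  have := Hd s; rewrite /ball_/= distrC => /(_ sr srN s0).
  by rewrite E// ler_pdivrMr ?normr_gt0 ?subr_eq0.
apply/cvgrPdist_le => e e0; have [d d0 Hd] := H e e0.
exists d => //= s; rewrite /ball_/= distrC => sd sr s0.
by rewrite E// ler_pdivrMr ?normr_gt0 ?subr_eq0//; exact: Hd.
Qed.

Lemma half_line_proper r : 0 <= r -> ProperFilter (within half_line r^').
Proof.
move=> r0; split; last exact: within_filter.
move=> [d /= d0 Hd]; have d2 : 0 < d / 2 by rewrite divr_gt0.
apply: (Hd (r + d / 2)) => /=.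
- by rewrite /ball_/= opprD addNKr normrN gtr0_norm// ltr_pdivrMr// ltr_pMr// ltr1n.
- by rewrite -subr_eq0 addrAC subrr add0r gt_eqF.
- by rewrite /half_line/= addr_ge0// ltW.
Qed.

Lemma is_half_derive_val u r l : 0 <= r -> is_half_derive u r l ->
  half_derivable u r /\ half_derive u r = l.
Proof.
move=> r0 /(half_quotient_cvgP _ _ r0) H; split; first by apply/cvg_ex; exists l.
by have ? := half_line_proper r0; exact: cvg_lim.
Qed.

Lemma half_derivableP u r : 0 <= r -> half_derivable u r ->
  is_half_derive u r (half_derive u r).
Proof. by move=> r0 H; exact/half_quotient_cvgP. Qed.

Lemma is_half_deriveE u r l : 0 < r -> is_half_derive u r l <-> is_derive r 1 u l.
Proof.
move=> r0; split=> [H|/is_deriveP H].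
  apply/is_deriveP => e e0; have [d d0 Hd] := H e e0.
  exists (Num.min d r); first by rewrite lt_min d0.
  move=> s; rewrite lt_min => /andP[sd]; rewrite ltr_norml => /andP[sr _].
  by apply: Hd => //; lra.
by move=> e e0; have [d d0 Hd] := H e e0; exists d => // s _; exact: Hd.
Qed.

Lemma eq_is_half_derive u v r l : (forall s, 0 <= s -> u s = v s) -> 0 <= r ->
  is_half_derive u r l -> is_half_derive v r l.
Proof.
move=> uv r0 H e e0; have [d d0 Hd] := H e e0; exists d => // s s0 sr.
by rewrite -!uv//; exact: Hd.
Qed.

Lemma is_half_derive_continuous u : (forall r, 0 <= r -> exists l, is_half_derive u r l) ->
  continuous (fun s : R => u `|s|).
Proof.
move=> H x; apply/cvgrPdist_le => e e0.
have [l Hl] := H `|x| (normr_ge0 x).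
have [d d0 Hd] := Hl 1 ltr01.
have l1 : 0 < `|l| + 1 by rewrite ltr_wpDl.
exists (Num.min d (e / (`|l| + 1))); first by rewrite /= lt_min d0 divr_gt0.
move=> s; rewrite /ball_/= lt_min => /andP[sd se].
have sx : `| `|s| - `|x| | <= `|x - s| by rewrite distrC ler_dist_dist.
have := Hd `|s| (normr_ge0 s) (le_lt_trans sx sd); rewrite mul1r => h.
have h2 : `|u `|s| - u `|x| | <= (`|l| + 1) * `|x - s|.
  rewrite (_ : _ - _ = (u `|s| - u `|x| - l * (`|s| - `|x|)) + l * (`|s| - `|x|)); last by ring.
  apply: (le_trans (ler_normD _ _)); rewrite normrM.
  have : `|l| * `| `|s| - `|x| | <= `|l| * `|x - s| by rewrite ler_wpM2l.
  lra.
rewrite distrC (le_trans h2)// mulrC -ler_pdivlMr//; exact: ltW.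
Qed.

(** By the mean value theorem the difference quotient at 0 is a value of [p] at an intermediate
    point, and [p] is continuous at 0. *)
Lemma is_half_derive0 u p : continuous u -> continuous p ->
  (forall r, 0 < r -> is_derive r 1 u (p r)) -> is_half_derive u 0 (p 0).
Proof.
move=> cu cp du e e0.
have /cvgrPdist_le/(_ e e0)[d /= d0 Hd] := cp 0.
exists d => // s s0 sd; rewrite subr0 in sd *.
have [x x0||c cs ->] := @MVT_segment _ u p 0 s s0.
- by apply: du; move: x0; rewrite in_itv/= => /andP[].
- exact: continuous_subspaceT.
move: cs; rewrite in_itv/= subr0 => /andP[c0 cs].
rewrite -mulrBl normrM ler_wpM2r// distrC Hd// /ball_/= sub0r normrN ger0_norm//.
by apply: le_lt_trans sd; rewrite ger0_norm.
Qed.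

End half_derivatives.

(** * Partial derivatives and Laplacian of radial functions *)

Section radial_calculus.
Context {R : realType} {N : nat}.
Implicit Types (x y : 'rV[R]_N) (v p q : R -> R) (i : 'I_N).

Lemma enorm_ge0 x : 0 <= enorm x.
Proof. exact: sqrtr_ge0. Qed.

Lemma enorm_sqr x : enorm x ^+ 2 = \sum_(i < N) x 0 i ^+ 2.
Proof. by rewrite /enorm sqr_sqrtr// sumr_ge0// => i _; exact: sqr_ge0. Qed.

Lemma enorm_line x i (t : R) :
  enorm (t *: delta_mx 0 i + x) = Num.sqrt (enorm x ^+ 2 + 2 * t * x 0 i + t ^+ 2).
Proof.
rewrite /enorm -/(enorm x); congr Num.sqrt; rewrite enorm_sqr.
rewrite (bigD1 i)//= [in RHS](bigD1 i)//= !mxE !eqxx/=.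
rewrite (eq_bigr (fun j => x 0 j ^+ 2)); last first.
  by move=> j ji; rewrite !mxE (negbTE ji) andbF mulr0 add0r.
by ring.
Qed.

Lemma derive_line (g : 'rV[R]_N -> R) x y (l : R) :
  is_derive (0 : R) 1 (fun t : R => g (t *: y + x)) l -> 'D_y g x = l.
Proof.
move=> d; rewrite -(@derive_val _ _ _ _ _ _ _ d) /derive.
rewrite (_ : (fun h : R => h^-1 *: ((g \o shift x) (h *: y) - g x)) =
  (fun h : R => h^-1 *: (((fun t : R => g (t *: y + x)) \o shift (0 : R)) (h *: (1 : R)) -
     g ((0 : R) *: y + x))))//.
apply/funext => h /=.
by rewrite addr0 scale0r add0r /GRing.scale/= mulr1.
Qed.

Lemma is_derive_enorm_line x i : 0 < enorm x ->
  is_derive (0 : R) 1 (fun t : R => enorm (t *: delta_mx 0 i + x)) (x 0 i / enorm x).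
Proof.
move=> x0; pose g (t : R) := enorm x ^+ 2 + 2 * t * x 0 i + t ^+ 2.
have dg : is_derive (0:R) 1 g (2 * x 0 i).
  by rewrite /g; derive_eq; rewrite /=; ring.
have g0 : g 0 = enorm x ^+ 2 by rewrite /g; ring.
have ds : is_derive (g 0) 1 Num.sqrt (2 * Num.sqrt (g 0))^-1.
  by apply: is_derive1_sqrt; rewrite g0 exprn_gt0.
apply: (@near_eq_is_derive _ _ _ (fun t => Num.sqrt (g t))).
  by apply: filterE => t; rewrite enorm_line.
apply: is_derive_eq (is_derive_fcomp ds dg) _.
rewrite g0 sqrtr_sqr gtr0_norm//; field.
by rewrite gt_eqF.
Qed.

(** At the origin the restriction to an axis is [t |-> v |t|], differentiable because [v'(0) = 0];
    the quotient by [enorm x = 0] on the right is harmless since [p 0 = 0]. *)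
Lemma partial_radial v p x i : (forall r, 0 <= r -> is_half_derive v r (p r)) ->
  p 0 = 0 -> partial i (radial v) x = p (enorm x) * (x 0 i / enorm x).
Proof.
move=> dv p0; apply: derive_line.
have := enorm_ge0 x; rewrite le_eqVlt => /orP[/eqP x0|x0].
  rewrite -x0 p0 mul0r; apply/is_deriveP => e e0.
  have [d d0 Hd] := dv 0 (lexx 0) e e0.
  exists d => // t; rewrite subr0 mul0r subr0 => td.
  have xi : x 0 i = 0.
    have /eqP := enorm_sqr x; rewrite -x0 expr0n/= eq_sym psumr_eq0.
      by move=> /allP/(_ i (mem_index_enum _)); rewrite /= sqrf_eq0 => /eqP.
    by move=> j _; exact: sqr_ge0.
  rewrite /radial scale0r add0r -x0 enorm_line xi -x0 expr0n/= mulr0 !add0r sqrtr_sqr.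
  have := Hd `|t|; rewrite p0 mul0r !subr0 normr_id; exact.
have dv' : is_derive (enorm x) 1 v (p (enorm x)).
  by apply/is_half_deriveE => //; exact: (dv _ (ltW x0)).
have dE := is_derive_enorm_line i x0.
apply: is_derive_fcomp dE; by rewrite scale0r add0r.
Qed.

(** At the origin the first partial derivative along its own axis is [p |t| t / |t|], the odd
    extension of [p], whose derivative at 0 is [q 0]. *)
Lemma partial_partial_radial v p q x i :
  (forall r, 0 <= r -> is_half_derive v r (p r)) ->
  (forall r, 0 <= r -> is_half_derive p r (q r)) -> p 0 = 0 ->
  partial i (partial i (radial v)) x = if enorm x == 0 then q 0 else
    q (enorm x) * (x 0 i / enorm x) ^+ 2 +
    p (enorm x) * ((enorm x)^-1 - x 0 i ^+ 2 / enorm x ^+ 3).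
Proof.
move=> dv dp p0.
rewrite (_ : partial i (radial v) = fun y => p (enorm y) * (y 0 i / enorm y)); last first.
  by apply/funext => y; exact: partial_radial.
apply: derive_line; case: ifPn => [/eqP x0|].
  apply/is_deriveP => e e0.
  have [d d0 Hd] := dp 0 (lexx 0) e e0.
  exists d => // t; rewrite subr0 => td.
  have xi : x 0 i = 0.
    have /eqP := enorm_sqr x; rewrite x0 expr0n/= eq_sym psumr_eq0.
      by move=> /allP/(_ i (mem_index_enum _)); rewrite /= sqrf_eq0 => /eqP.
    by move=> j _; exact: sqr_ge0.
  rewrite scale0r add0r x0 p0 mul0r subr0 enorm_line xi x0 expr0n/= mulr0 !add0r sqrtr_sqr.
  rewrite !mxE !eqxx/= mulr1 xi addr0.
  have [->|t0] := eqVneq t 0; first by rewrite !normr0 !mul0r !mulr0 subrr normr0.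
  have := Hd `|t|; rewrite p0 !subr0 normr_id => /(_ (normr_ge0 t) td) h.
  have tn : `|t| != 0 by rewrite normr_eq0.
  rewrite (_ : _ - _ = (p `|t| - q 0 * `|t|) * (t / `|t|)).
    by rewrite normrM normrM normfV normr_id divff// mulr1.
  rewrite mulrBl; congr (_ - _); rewrite -mulrA; congr (_ * _).
  by rewrite mulrCA divff// mulr1.
rewrite -normr_gt0 (ger0_norm (enorm_ge0 x)) => x0.
have xn0 : enorm x != 0 by rewrite gt_eqF.
have dE := is_derive_enorm_line i x0.
have E0 : enorm (0 *: delta_mx 0 i + x) = enorm x by rewrite scale0r add0r.
have dp' : is_derive (enorm (0 *: delta_mx 0 i + x)) 1 p (q (enorm x)).
  by rewrite E0; apply/is_half_deriveE => //; exact: (dp _ (ltW x0)).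
have dpE := @is_derive_fcomp _ p (fun t => enorm (t *: delta_mx 0 i + x)) 0 _ _ dp' dE.
have En0 : enorm ((0 : R) *: delta_mx 0 i + x) != 0 by rewrite E0.
have dV := @is_derive_fV _ (fun t => enorm (t *: delta_mx 0 i + x)) 0 _ En0 dE.
apply: (@near_eq_is_derive _ _ _ (fun t : R => p (enorm (t *: delta_mx 0 i + x)) *
    ((t + x 0 i) * (enorm (t *: delta_mx 0 i + x))^-1))).
  by apply: filterE => t; rewrite !mxE !eqxx/= mulr1.
derive_eq; rewrite E0; field.
by rewrite xn0.
Qed.

Lemma laplacian_radial v p q x :
  (forall r, 0 <= r -> is_half_derive v r (p r)) ->
  (forall r, 0 <= r -> is_half_derive p r (q r)) -> p 0 = 0 ->
  laplacian (radial v) x = if enorm x == 0 then N%:R * q 0 else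
    q (enorm x) + (N%:R - 1) / enorm x * p (enorm x).
Proof.
move=> dv dp p0; rewrite /laplacian.
under eq_bigr do rewrite (partial_partial_radial _ _ dv dp p0).
case: ifPn => x0; first by rewrite sumr_const card_ord mulr_natl.
have sx : \sum_(i < N) (x 0 i / enorm x) ^+ 2 = 1.
  under eq_bigr do rewrite exprMn.
  by rewrite -mulr_suml -enorm_sqr exprVn divff// expf_neq0.
have sx3 : \sum_(i < N) x 0 i ^+ 2 / enorm x ^+ 3 = (enorm x)^-1.
  by rewrite -mulr_suml -enorm_sqr; field.
rewrite big_split/= -mulr_sumr sx mulr1; congr (_ + _).
rewrite -mulr_sumr sumrB sx3 sumr_const card_ord -[_ *+ N]mulr_natl.
by field.
Qed.

Lemma grad_norm_radial v p x : (forall r, 0 <= r -> is_half_derive v r (p r)) ->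
  p 0 = 0 -> grad_norm (radial v) x = `|p (enorm x)|.
Proof.
move=> dv p0; rewrite /grad_norm.
under eq_bigr do rewrite (partial_radial _ _ dv p0) exprMn exprMn exprVn.
rewrite -mulr_sumr -mulr_suml -enorm_sqr.
have [->|x0] := eqVneq (enorm x) 0; first by rewrite p0 expr0n/= mul0r sqrtr0 normr0.
by rewrite divff ?expf_neq0// mulr1 sqrtr_sqr.
Qed.

End radial_calculus.

(** * Equivalence of the partial differential equation and the radial equation *)

Section radial_solutions.
Context {R : realType} (N : nat) (k : R) (f : R -> R -> R).
Hypotheses (hN : (2 <= N)%N) (k0 : 0 < k).
Hypotheses (g1 : assumption_g1 f).
Local Notation m := (N - 1)%N.
Implicit Types (u v p q : R -> R) (r s a : R).

Let m0 : (0 < m)%N. Proof. by rewrite subn_gt0. Qed.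
Let mE : m%:R = N%:R - 1 :> R. Proof. by rewrite natrB// ltnW. Qed.
Let NR0 : N%:R != 0 :> R. Proof. by rewrite pnatr_eq0; case: N hN. Qed.

(* At the origin the equation forces [N u''(0) + k^2 u(0) + f (0, u(0)) = 0]. *)
Definition radial_second u p r : R :=
  if r == 0 then - (k ^+ 2 * u 0 + f 0 (u 0)) / N%:R
  else - (k ^+ 2 * u r + f r (u r)) - m%:R / r * p r.

(** At the origin [l] satisfies [h 0 = - (m + 1) l], so the difference between the flux [s^m p] and
    [l s^(m+1)] has derivative [s^m (h 0 - h s)]. Integrating this small quantity bounds [p s - l s]
    by [e s]. *)
Lemma is_half_derive_radial_ode u p : radial_ode m k f u p -> p 0 = 0 ->
  forall r, 0 <= r -> is_half_derive p r (radial_second u p r).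
Proof.
move=> ode p0 r; have [cu cp du dp] := ode.
rewrite le_eqVlt => /orP[/eqP <-|r0]; last first.
  apply/is_half_deriveE => //; rewrite /radial_second gt_eqF//.
  exact: is_derive_radial_ode.
rewrite /radial_second eqxx; set l := _ / _.
pose h s := k ^+ 2 * u s + f `|s| (u s).
have ch : continuous h.
  have cf : continuous (fun s => f `|s| (u s)).
    by apply: (@continuous_superposition _ (fun s x => f `|s| x)) => //; exact: continuous_norm_fst.
  by rewrite /h; continuous_formula.
have lE : h 0 = - (l * m.+1%:R).
  by rewrite /l /h normr0 -natr1 mE; field.
move=> e e0; have /cvgrPdist_le/(_ e e0)[d /= d0 Hd] := ch 0.
exists d => // s s0 sd; rewrite p0 !subr0 in sd *.
have [->|sn0] := eqVneq s 0; first by rewrite p0 mulr0 subrr !normr0 mulr0.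
have {sn0} sp : 0 < s by rewrite lt_def sn0.
have sm : 0 < s ^+ m by rewrite exprn_gt0.
rewrite -(ler_pM2l sm) -{1}(gtr0_norm sm) -normrM mulrBr.
rewrite (ger0_norm s0).
have sS b : s ^+ m * (b * s) = b * s ^+ m.+1 by rewrite exprSr mulrCA.
rewrite !sS.
apply: (@norm_derive_le _ (fun t => t ^+ m * p t - l * t ^+ m.+1)
  (fun t => e * t ^+ m.+1) (fun t => - (t ^+ m * h t) - l * (m.+1%:R * t ^+ m))
  (fun t => e * (m.+1%:R * t ^+ m)) 0 s s0).
- by continuous_formula.
- by continuous_formula.
- move=> t t0 ts; have := dp t t0 => ?; have ? := is_derive_exprn m.+1 t.
  by derive_eq; rewrite /h (gtr0_norm t0) /=; ring.
- by move=> t t0 ts; derive_eq; rewrite /=; ring.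
- move=> t t0 ts; have tm : 0 <= t ^+ m by rewrite exprn_ge0// ltW.
  rewrite (_ : _ - _ = t ^+ m * (h 0 - h t)); last by rewrite lE; ring.
  rewrite normrM (ger0_norm tm) [leRHS](_ : _ = t ^+ m * (m.+1%:R * e)); last by ring.
  rewrite ler_wpM2l// (@le_trans _ _ e)//; last by rewrite ler_peMl ?ler1n// ltW.
  apply: Hd; rewrite /ball_/= sub0r normrN gtr0_norm//.
  by rewrite (lt_trans ts)// -(gtr0_norm sp).
- by rewrite !expr0n/= (gtn_eqF m0) mul0r !mulr0 subrr normr0.
Qed.

Lemma continuous_radial_second u p : radial_ode m k f u p -> p 0 = 0 ->
  {within half_line, continuous (radial_second u p)}.
Proof.
move=> ode p0; have [cu cp du dp] := ode.
pose h s := k ^+ 2 * u s + f `|s| (u s).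
have ch : continuous h.
  have cf : continuous (fun s => f `|s| (u s)).
    by apply: (@continuous_superposition _ (fun s x => f `|s| x)) => //; exact: continuous_norm_fst.
  by rewrite /h; continuous_formula.
apply/subspace_continuousP => r; rewrite /half_line/= le_eqVlt => /orP[/eqP <-|r0].
  have H := is_half_derive_radial_ode ode p0 (lexx 0).
  set l := radial_second u p 0 in H *.
  (* This is the equation at the origin with [p s / s] replaced by its limit [l]; subtracting it
     from the equation at [s] leaves two terms tending to 0. *)
  have lE : l = - h 0 - m%:R * l.
    by rewrite /l /radial_second eqxx /h normr0 mE; field.
  apply/cvgrPdist_le => e e0.
  have m1 : 0 < 1 + m%:R :> R by rewrite ltr_pwDl.
  have e1 : 0 < e / (1 + m%:R) by rewrite divr_gt0.
  have [d1 d10 H1] := H _ e1.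
  have /cvgrPdist_le/(_ _ e1)[d2 /= d20 H2] := ch 0.
  exists (Num.min d1 d2); rewrite /= ?lt_min ?d10// => s; rewrite /ball_/= lt_min.
  move=> /andP[s1 s2] s0.
  have [->|sn0] := eqVneq s 0; first by rewrite subrr normr0 ltW.
  have {sn0} sp : 0 < s by rewrite lt_def sn0.
  have := H1 s s0; rewrite p0 !subr0 distrC => h1; move: s1; rewrite distrC subr0 => /h1 {}h1.
  have {}H2 := H2 s s2.
  change (`|l - radial_second u p s| <= e).
  rewrite [radial_second u p s]/radial_second gt_eqF//.
  rewrite (_ : l - _ = m%:R * (p s / s - l) - (h 0 - h s)); last first.
    by rewrite {1}lE /h (gtr0_norm sp); field; rewrite gt_eqF.
  apply: (le_trans (ler_normB _ _)).
  rewrite (_ : e = m%:R * (e / (1 + m%:R)) + e / (1 + m%:R)); last first.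
    by field; rewrite gt_eqF.
  apply: lerD => //; rewrite normrM ger0_norm// ler_wpM2l//.
  rewrite (_ : p s / s - l = (p s - l * s) / s); last by field; rewrite gt_eqF.
  rewrite normrM normfV ler_pdivrMr ?normr_gt0 ?gt_eqF// distrC.
  exact: h1.
apply: cvg_within_filter.
change (radial_second u p s @[s --> r] --> radial_second u p r).
have -> : radial_second u p r = - h r - m%:R / r * p r.
  by rewrite /radial_second gt_eqF// /h gtr0_norm.
apply: (@cvg_trans _ ((fun s => - h s - m%:R / s * p s) @ r)).
  apply: near_eq_cvg; near=> s; have s0 : 0 < s by near: s; exact: lt_nbhsr.
  by rewrite /radial_second gt_eqF// /h gtr0_norm.
have h1 : - h s @[s --> r] --> - h r by apply: cvgN; exact: ch.
have h2 : s^-1 @[s --> r] --> r^-1 by apply: cvgV; rewrite ?gt_eqF//; exact: cvg_id.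
exact: (cvgB h1 (cvgM (cvgM (cvg_cst (m%:R : R)) h2) (cp r))).
Unshelve. all: by end_near. Qed.

Lemma half_derive_radial_ode u p : radial_ode m k f u p -> p 0 = 0 ->
  [/\ forall r, 0 <= r -> is_half_derive u r (p r),
      forall r, 0 <= r -> half_derive u r = p r &
      forall r, 0 <= r -> is_half_derive (half_derive u) r (radial_second u p r)].
Proof.
move=> ode p0; have [cu cp du dp] := ode.
have H r : 0 <= r -> is_half_derive u r (p r).
  rewrite le_eqVlt => /orP[/eqP <-|r0]; first exact: is_half_derive0.
  by apply/is_half_deriveE => //; exact: du.
have E r : 0 <= r -> half_derive u r = p r.
  by move=> r0; have [] := is_half_derive_val r0 (H r r0).
split=> // r r0; apply: eq_is_half_derive (is_half_derive_radial_ode ode p0 r0) => //.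
by move=> s s0; rewrite E.
Qed.

Lemma radial_ode_solution u p a : radial_ode m k f u p -> p 0 = 0 -> u 0 = a ->
  radial_solution_ivp N k f a u.
Proof.
move=> ode p0 u0; have [du E dp] := half_derive_radial_ode ode p0.
split => //; last by rewrite E.
split.
  split=> [r r0|r r0|].
  - by have [] := is_half_derive_val r0 (du r r0).
  - by have [] := is_half_derive_val r0 (dp r r0).
  - apply/subspace_continuousP => r r0.
    have E2 s : 0 <= s -> half_derive2 u s = radial_second u p s.
      by move=> s0; have [] := is_half_derive_val s0 (dp s s0).
    have /subspace_continuousP/(_ r r0) H := continuous_radial_second ode p0.
    change (half_derive2 u s @[s --> within half_line (nbhs r)] --> half_derive2 u r).
    rewrite E2//; apply: cvg_trans H; apply: near_eq_cvg; rewrite near_withinE.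
    by near=> s => s0; rewrite E2.
move=> x; rewrite (laplacian_radial x du (is_half_derive_radial_ode ode p0) p0).
rewrite /radial; case: ifPn => [/eqP ->|x0]; rewrite /radial_second ?eqxx ?(negbTE x0).
  by field.
by rewrite mE; ring.
Unshelve. all: by end_near. Qed.

Lemma solution_radial_ode v a : radial_solution_ivp N k f a v ->
  exists p, radial_ode m k f (fun s => v `|s|) p.
Proof.
move=> [[[dv dp _] lap] va p0].
have {}dv r : 0 <= r -> is_half_derive v r (half_derive v r).
  by move=> r0; apply: half_derivableP => //; exact: dv.
have {}dp r : 0 <= r -> is_half_derive (half_derive v) r (half_derive2 v r).
  by move=> r0; apply: half_derivableP => //; exact: dp.
exists (fun s => half_derive v `|s|); split.
- by apply: is_half_derive_continuous => r r0; eexists; exact: dv.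
- by apply: is_half_derive_continuous => r r0; eexists; exact: dp.
- move=> r r0; rewrite gtr0_norm//.
  apply: (@near_eq_is_derive _ _ _ v).
    by near=> s; rewrite gtr0_norm//; near: s; exact: lt_nbhsr.
  by apply/is_half_deriveE => //; exact: (dv _ (ltW r0)).
- move=> r r0.
  have dpr : is_derive r 1 (half_derive v) (half_derive2 v r).
    by apply/is_half_deriveE => //; exact: (dp _ (ltW r0)).
  have i0 : 'I_N by exists 0%N; exact: ltnW.
  (* The equation on a single coordinate axis already determines the radial equation; the zero
     summand matches the form of [enorm_line]. *)
  have := lap (r *: delta_mx 0 i0 + 0).
  rewrite (laplacian_radial _ dv dp p0) /radial enorm_line.
  have -> : enorm (0 : 'rV[R]_N) = 0.
    by rewrite /enorm big1 ?sqrtr0// => i _; rewrite mxE expr0n.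
  rewrite mxE mulr0 addr0 expr0n/= add0r sqrtr_sqr gtr0_norm// gt_eqF// -mE => eq.
  have dm := is_derive_exprn m r.
  apply: (@near_eq_is_derive _ _ _ (fun s => s ^+ m * half_derive v s)).
    by near=> s; rewrite (@gtr0_norm _ s)//; near: s; exact: lt_nbhsr.
  derive_eq; move: eq; case: (m) m0 => // n _ eq; rewrite -eq /= exprS.
  by field; rewrite gt_eqF.
Unshelve. all: by end_near. Qed.

End radial_solutions.

(** * Square integrability of radial functions *)

Section radial_L2.
Context {R : realType} (N : nat).
Local Notation RT := (measurableTypeR R).
Implicit Types (t : N.-tuple RT) (h w : R -> R).

Let E t : R := enorm (tuple_row t).

Let sqrt_sqr t : E t = Num.sqrt (\sum_(i < N) tnth t i ^+ 2).
Proof. by rewrite /E /enorm; congr Num.sqrt; apply: eq_bigr => i _; rewrite mxE. Qed.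

Lemma measurable_enorm_row : measurable_fun [set: N.-tuple RT] E.
Proof.
rewrite (_ : E = Num.sqrt \o (fun t => \sum_(i < N) tnth t i ^+ 2)); last first.
  by apply/funext => t; exact: sqrt_sqr.
apply: (measurableT_comp (f := (Num.sqrt : RT -> RT))).
  apply: continuous_measurable_fun; exact: sqrt_continuous.
apply: measurable_sum => i; apply: measurable_funX; exact: measurable_tnth.
Qed.

Lemma ler_tnth_enorm t (i : 'I_N) : `|tnth t i| <= E t.
Proof.
rewrite sqrt_sqr -sqrtr_sqr ler_wsqrtr// (bigD1 i)//= lerDl sumr_ge0// => j _.
exact: sqr_ge0.
Qed.

(** Cubes stand in for balls of radius [2^j]: they contain them, and their measure is a product of
    lengths. *)
Let box (j : nat) : set (N.-tuple RT) :=
  [set t | forall i, - 2 ^+ j <= tnth t i <= 2 ^+ j].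

Let measurable_box j : measurable (box j).
Proof.
rewrite (_ : box j = \bigcap_(i in [set: 'I_N])
    ((fun t : N.-tuple RT => tnth t i) @^-1` `[- 2 ^+ j, 2 ^+ j])); last first.
  by apply/seteqP; split => t /= H i; [move=> _|have := H i I];
    rewrite /= in_itv /=; [exact: H|].
apply: fin_bigcap_measurable => // i _.
by rewrite -[X in measurable X]setTI; apply: measurable_tnth.
Qed.

Let measure_box j : lebesgue_tuple N (box j) = ((2 ^+ j.+1) ^+ N)%:E.
Proof.
rewrite (@lebesgue_tuple_box _ N (fun=> - 2 ^+ j) (fun=> 2 ^+ j)); last first.
  by move=> _; rewrite ge0_cp// exprn_ge0.
rewrite prodr_const card_ord; congr ((_ ^+ N)%:E).
by rewrite opprK exprS mulr_natl mulr2n.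
Qed.

(* [h (|t|)^2] is at most a multiple of [2^-(j (N + 1))] where
   [2^(j-1) < |t| <= 2^j], a set of measure at most [2^((j + 1) N)]. *)
Lemma radial_in_L2 h (C : R) : continuous h ->
  (forall r, 1 <= r -> r ^+ N.+1 * h r ^+ 2 <= C) ->
  in_L2 (fun x : 'rV[R]_N => h (enorm x)).
Proof.
move=> ch hC; rewrite /in_L2.
set g := (_ \o _); have gE t : g t = h (E t) by [].
have mg : measurable_fun [set: N.-tuple RT] (g : N.-tuple RT -> RT).
  apply: (measurableT_comp (f := (h : RT -> RT))); last exact: measurable_enorm_row.
  exact: continuous_measurable_fun.
have C0 : 0 <= C.
  by apply: le_trans (hC 1 (lexx _)); rewrite expr1n mul1r sqr_ge0.
have [B B0 HB] := continuous_itv_bounded 1 ch.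
(* [B^2] serves the unit ball, [j = 0]; the factor [2^(N+1)] comes from the lower bound [2^(j-1)],
   instead of [2^j], on the radius in the other shells. *)
pose A := B ^+ 2 + C * 2 ^+ N.+1.
have A0 : 0 <= A by rewrite addr_ge0 ?sqr_ge0// mulr_ge0// exprn_ge0.
pose c j := A * (2 ^+ j) ^- N.+1.
have c0 j : 0 <= c j by rewrite mulr_ge0// invr_ge0 !exprn_ge0.
have bound t : exists j, box j t /\ g t ^+ 2 <= c j.
  have ex : exists j, E t <= 2 ^+ j.
    exists (Num.bound (E t)); apply: ltW.
    apply: (lt_le_trans (archi_boundP (enorm_ge0 _))).
    by rewrite -natrX ler_nat ltnW// ltn_expl.
  pose j := ex_minn ex; exists j.
  rewrite /j; case: ex_minnP => {}j Ej jmin; split.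
    move=> i; rewrite -ler_norml; exact: le_trans (ler_tnth_enorm _ _) Ej.
  rewrite gE; case: j Ej jmin => [|j] Ej jmin.
    rewrite /c expr0 expr1n invr1 mulr1 /A.
    have := HB (E t) (enorm_ge0 _) Ej => hB.
    rewrite -[leLHS]addr0 lerD ?mulr_ge0 ?exprn_ge0//.
    by rewrite -[leLHS]real_normK ?num_real// ler_pXn2r ?nnegrE.
  have Ej' : 2 ^+ j < E t.
    by rewrite ltNge; apply/negP => /jmin; rewrite ltnn.
  have j1 : 1 <= 2 ^+ j :> R by rewrite exprn_ege1// ler1n.
  have E0 : 0 < E t by exact: lt_trans (lt_le_trans ltr01 j1) Ej'.
  have j0 : 0 < (2 : R) ^+ j by exact: lt_le_trans j1.
  have := hC (E t) (ltW (le_lt_trans j1 Ej')).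
  rewrite -ler_pdivlMl ?exprn_gt0// => /le_trans; apply.
  apply: (@le_trans _ _ ((2 ^+ j) ^- N.+1 * C)).
    by rewrite ler_wpM2r// lef_pV2 ?posrE ?exprn_gt0// ler_pXn2r ?nnegrE// ltW.
  rewrite /c (_ : _ ^- N.+1 * C = C * 2 ^+ N.+1 * (2 ^+ j.+1) ^- N.+1); last first.
    by rewrite (exprS 2 j) exprMn; field; rewrite !expf_neq0// gt_eqF.
  by rewrite ler_wpM2r ?invr_ge0 ?exprn_ge0// /A lerDr sqr_ge0.
apply/andP; split; rewrite inE/=; first exact: mg.
rewrite /finite_norm unlock; apply: poweR_lty.
pose F j (t : N.-tuple RT) : \bar R := ((c j)%:E * (\1_(box j) t)%:E)%E.
have F0 j t : (0 <= F j t)%E by rewrite mule_ge0// lee_fin.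
have mF j : measurable_fun [set: N.-tuple RT] (F j).
  apply: measurable_funeM; apply/measurable_EFinP; exact: measurable_indic.
have -> : (fun t => `|(EFin \o g) t| `^ 2)%E = (fun t => (g t ^+ 2)%:E).
  by apply/funext => t; rewrite /= powR_mulrn// real_normK// num_real.
apply: (@le_lt_trans _ _ (\int[lebesgue_tuple N]_t (\sum_(0 <= j <oo) F j t)%E)%E).
  apply: ge0_le_integral => //.
  - by move=> t _; rewrite lee_fin sqr_ge0.
  - by apply/measurable_EFinP; exact: measurable_funX.
  - exact: ge0_emeasurable_sum.
  - move=> t _; have [j [tj gj]] := bound t.
    apply: (@le_trans _ _ (F j t)).
      by rewrite /F indicE mem_set// mule1 lee_fin.
    apply: le_trans (nneseries_lim_ge j.+1 _) => //.
    by rewrite big_nat_recr//= leeDr// sume_ge0.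
rewrite integral_nneseries//.
(* The weight [(2^j)^-(N+1)] beats the volume [(2^(j+1))^N] by [2^-j], so the series is
   geometric. *)
have intF j : (\int[lebesgue_tuple N]_t F j t = (2 * A * 2 ^+ N / (2 ^ (j + 1))%:R)%:E)%E.
  rewrite ge0_integralZl_EFin//; last first.
    by apply/measurable_EFinP; exact: measurable_indic.
  have -> : (\int[lebesgue_tuple N]_t (\1_(box j) t)%:E = ((2 ^+ j.+1) ^+ N)%:E)%E.
    by rewrite integral_indic// setIT; exact: measure_box.
  rewrite -EFinM; congr EFin.
  rewrite /c natrX addn1 !exprS !exprMn.
  by field; rewrite !expf_neq0.
rewrite (eq_eseriesr (fun j _ => intF j)).
by rewrite (cvg_lim _ (@cvg_geometric_eseries_half R (2 * A * 2 ^+ N) 0%N))//= expr0 divr1 ltry.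
Qed.

End radial_L2.

(** * Asymptotic conditions at infinity *)

Section asymptotics.
Context {R : realType} (N : nat) (k : R) (f : R -> R -> R).
Hypotheses (hN : (2 <= N)%N).
Local Notation m := (N - 1)%N.
Implicit Types (u p : R -> R) (r : R).

Let G r : R := r `^ ((1 - N%:R) / 2).

Let G_sqr r : 0 < r -> G r ^+ 2 = (r ^+ m)^-1.
Proof.
move=> r0; rewrite /G -powR_mulrn ?powR_ge0// -powRrM divfK// -powR_mulrn; last exact: ltW.
by rewrite natrB ?(ltnW hN)// -powRN opprB.
Qed.

Let bound_G u C r : 0 < r -> r ^+ m * u r ^+ 2 <= C -> `|u r| <= Num.sqrt C * G r.
Proof.
move=> r0 H; have rm : 0 < r ^+ m by rewrite exprn_gt0.
have C0 : 0 <= C by apply: le_trans H; rewrite mulr_ge0 ?sqr_ge0// ltW.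
rewrite -(@ler_pXn2r _ 2)// ?nnegrE ?mulr_ge0 ?sqrtr_ge0 ?powR_ge0//.
by rewrite real_normK ?num_real// exprMn sqr_sqrtr// G_sqr// ler_pdivlMr// mulrC.
Qed.

(** With [G] as the power in the conclusion, [u] and [p] are both [O(G)]. The equation gives
    [u'' + k^2 u = - f - (m / r) p], where the first term is [o(|u|)] by (g_4) and the second is
    [O(G / r)]. *)
Lemma radial_asymptotics u p (C : R) : (forall r, 1 <= r -> r ^+ m * (p r ^+ 2 + u r ^+ 2) <= C) ->
  (forall r, 0 < r -> half_derive2 u r =
    - (k ^+ 2 * u r + f r (u r)) - m%:R / r * p r) ->
  assumption_g4 f ->
  (fun x : 'rV[R]_N => radial u x)
    =O_at_infinity (fun x : 'rV[R]_N => enorm x `^ ((1 - N%:R) / 2)) /\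
  (fun x : 'rV[R]_N => radial (half_derive2 u) x + k ^+ 2 * radial u x)
    =o_at_infinity (fun x : 'rV[R]_N => enorm x `^ ((1 - N%:R) / 2)).
Proof.
move=> hC d2 g4.
have uG r : 1 <= r -> `|u r| <= Num.sqrt C * G r.
  move=> r1; have r0 : 0 < r by exact: lt_le_trans r1.
  apply: bound_G => //; apply: le_trans (hC r r1).
  by rewrite ler_wpM2l ?exprn_ge0 ?(ltW r0)// lerDr sqr_ge0.
have pG r : 1 <= r -> `|p r| <= Num.sqrt C * G r.
  move=> r1; have r0 : 0 < r by exact: lt_le_trans r1.
  apply: bound_G => //; apply: le_trans (hC r r1).
  by rewrite ler_wpM2l ?exprn_ge0 ?(ltW r0)// lerDl sqr_ge0.
have G0 r : 0 <= G r by exact: powR_ge0.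
split.
  apply/eqO_exP; exists (Num.sqrt C + 1); first by rewrite ltr_wpDl// sqrtr_ge0.
  exists 1 => // x /= x1; rewrite (ger0_norm (G0 _)).
  by apply: (le_trans (uG _ (ltW x1))); rewrite ler_wpM2r// lerDl.
apply/eqoP => e e0.
pose K := Num.sqrt C + 1; have K0 : 0 < K by rewrite ltr_wpDl// sqrtr_ge0.
have e1 : 0 < e / 2 / K by rewrite !divr_gt0.
have [d d0 Hd] := g4 _ e1.
(* Past [(K / d)^2], [G^2 <= 1 / r] forces [K G < d], so (g_4) applies to [u r]; past the last
   threshold [m K / r <= e / 2]. *)
pose M := Num.max 1 (Num.max ((K / d) ^+ 2) (m%:R * K / (e / 2))).
exists M => // x /=; rewrite !gt_max => /and3P[x1 x2 x3].
rewrite /radial; set r := enorm x in x1 x2 x3 *.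
have r0 : 0 < r by exact: lt_trans x1.
have {}uG : `|u r| <= K * G r.
  by apply: (le_trans (uG _ (ltW x1))); rewrite ler_wpM2r// lerDl.
have {}pG : `|p r| <= K * G r.
  by apply: (le_trans (pG _ (ltW x1))); rewrite ler_wpM2r// lerDl.
have Gr : G r < d / K.
  rewrite -(@ltr_pXn2r _ 2)// ?nnegrE ?divr_ge0 ?(ltW d0) ?(ltW K0)// G_sqr//.
  apply: (@le_lt_trans _ _ r^-1).
    rewrite lef_pV2 ?posrE ?exprn_gt0// -[leLHS]expr1 ler_weXn2l ?(ltW x1)//.
    by rewrite subn_gt0.
  rewrite -[ltRHS]invrK ltf_pV2 ?posrE//; first by rewrite -exprVn invf_div.
  by rewrite invr_gt0 exprn_gt0// divr_gt0.
have ud : `|u r| < d.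
  by apply: (le_lt_trans uG); rewrite mulrC -ltr_pdivlMr.
rewrite d2// -/(G r) (ger0_norm (G0 r)).
rewrite [X in `|X| <= _](_ : _ = - (f r (u r) + m%:R / r * p r)); last by ring.
rewrite normrN; apply: (le_trans (ler_normD _ _)).
rewrite (_ : e * G r = e / 2 / K * (K * G r) + e / 2 * G r); last first.
  by field; rewrite gt_eqF.
apply: lerD.
  by apply: (le_trans (Hd r (u r) r0 ud)); rewrite ler_wpM2l// ltW.
rewrite normrM ger0_norm; last by rewrite divr_ge0// ltW.
apply: (@le_trans _ _ (m%:R / r * (K * G r))).
  by rewrite ler_wpM2l// divr_ge0// ltW.
rewrite mulrA ler_wpM2r// mulrAC ler_pdivrMr// [leRHS]mulrC -ler_pdivrMr ?divr_gt0//.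
exact: ltW.
Qed.

End asymptotics.

Theorem theorem5p2 (R : realType) (N : nat) (k : R) (f : R -> R -> R)
  (hN : (2 <= N)%N) (hk : 0 < k)
  (g1 : assumption_g1 f) (g2 : assumption_g2 f) (g3 : assumption_g3 f)
  (a : R) :
  exists u : R -> R,
    [/\ radial_solution_ivp N k f a u,
        forall v : R -> R, radial_solution_ivp N k f a v ->
          forall r : R, 0 <= r -> v r = u r,
        (ereal_sup
           [set (r ^+ (N - 1) * (half_derive u r ^+ 2 + u r ^+ 2))%R%:E
           | r in [set r : R | (1 <= r)%R]] < +oo)%E,
        in_L2 (fun x : 'rV[R]_N =>
                 radial u x / Num.sqrt (1 + enorm x ^+ 2)) /\
        in_L2 (fun x : 'rV[R]_N =>
                 grad_norm (radial u) x / Num.sqrt (1 + enorm x ^+ 2)) &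
        assumption_g4 f ->
          (fun x : 'rV[R]_N => radial u x)
            =O_at_infinity
              (fun x : 'rV[R]_N => enorm x `^ ((1 - N%:R) / 2)) /\
          (fun x : 'rV[R]_N =>
             radial (half_derive2 u) x + k ^+ 2 * radial u x)
            =o_at_infinity
              (fun x : 'rV[R]_N => enorm x `^ ((1 - N%:R) / 2))].
Proof.
have m0 : (0 < N - 1)%N by rewrite subn_gt0.
have [u [p [ode u0 p0]]] := radial_ode_exists m0 hk g1 g2 g3 a.
have [cu cp du dp] := ode.
have [C hC] := radial_ode_decay m0 hk g1 g2 g3 ode.
have [dup up dpq] := half_derive_radial_ode hN g1 ode p0.
have L2 (w : R -> R) : continuous w ->
    (forall r, 1 <= r -> w r ^+ 2 <= p r ^+ 2 + u r ^+ 2) ->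
    in_L2 (fun x : 'rV[R]_N => w (enorm x) / Num.sqrt (1 + enorm x ^+ 2)).
  move=> cw wle.
  have pos (s : R) : 0 < 1 + s ^+ 2 by rewrite ltr_pwDl// sqr_ge0.
  apply: (@radial_in_L2 R N (fun s => w s / Num.sqrt (1 + s ^+ 2)) C).
    move=> s; apply: (@continuousM R R w (fun s => (Num.sqrt (1 + s ^+ 2))^-1)).
      exact: cw.
    apply: (@continuousV R R (fun s => Num.sqrt (1 + s ^+ 2))).
      by rewrite gt_eqF// sqrtr_gt0.
    apply: (@continuous_fcomp R Num.sqrt (fun s => 1 + s ^+ 2)).
      exact: sqrt_continuous.
    by continuous_formula.
  move=> r r1; have r0 : 0 < r by exact: lt_le_trans r1.
  have rm : 0 <= r ^+ (N - 1) by rewrite exprn_ge0// ltW.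
  rewrite exprMn exprVn sqr_sqrtr ?(ltW (pos r))// mulrA ler_pdivrMr//.
  (* Of the [N + 1] powers required, [N - 1] come from the decay bound and two from the weight
     [1 / (1 + r^2)]. *)
  rewrite (_ : N.+1 = (N - 1 + 2)%N); last by rewrite addn2 subn1 prednK// ltnW.
  have C0 : 0 <= C.
    by apply: le_trans (hC 1 (lexx _)); rewrite expr1n mul1r addr_ge0 ?sqr_ge0.
  apply: (@le_trans _ _ (C * r ^+ 2)).
    rewrite exprD -mulrA mulrCA [leRHS]mulrC ler_wpM2l ?sqr_ge0//.
    by apply: le_trans (hC r r1); rewrite ler_wpM2l// wle.
  by rewrite ler_wpM2l// lerDr.
exists u; split.
- exact: (radial_ode_solution hN g1 ode p0 u0).
- move=> v sv r r0; have [q odeq] := solution_radial_ode hN sv.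
  have [_ va _] := sv.
  have uv0 : u 0 = v `|0 : R| by rewrite normr0 va u0.
  by rewrite (radial_ode_unique m0 g1 ode odeq uv0 r0) ger0_norm.
- apply: (@le_lt_trans _ _ C%:E); last exact: ltry.
  apply: ge_ereal_sup => _ [r /= r1 <-]; rewrite lee_fin up ?hC//.
  exact: le_trans r1.
- split.
    by apply: (L2 u cu) => r _; rewrite lerDr sqr_ge0.
  rewrite (_ : (fun x => _) = (fun x : 'rV[R]_N =>
    `|p (enorm x)| / Num.sqrt (1 + enorm x ^+ 2))); last first.
    by apply/funext => x; rewrite (grad_norm_radial x dup p0).
  apply: (L2 (fun s => `|p s|) (continuous_fnorm cp)) => r _.
  by rewrite real_normK ?num_real// lerDl sqr_ge0.
- apply: (radial_asymptotics hN hC) => r r0.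
  have [_ E] := is_half_derive_val (ltW r0) (dpq r (ltW r0)).
  by rewrite /half_derive2 E /radial_second gt_eqF.
Qed.
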